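(* Let $T$ be a quaternionic torus. The group $Aut(T)$ of biregular automorphisms of $T$ contains a subgroup isomorphic to $2C_2\cong 2D_2$ if and only if there exist $I\in\mathbb S$ and a quaternion $\alpha_3$ with $|\alpha_3|\ge1$ such that $(I,\alpha_3,\alpha_3I)$ is (a representative of) the modulus of $T$.
   Context: $\mathbb H\cong\mathbb R^4$ is the skew field of quaternions with its Euclidean scalar product $\langle\cdot,\cdot\rangle$ and norm $|\cdot|$; $\mathbb S=\{q\in\mathbb H: q^2=-1\}$, $\mathbb S^3=\{q\in\mathbb H:|q|=1\}$. A function $f:\Omega\to\mathbb H$ on a domain $\Omega\subseteq\mathbb H$ is (slice) regular if for every $I\in\mathbb S$ its restriction $f_I$ to $\Omega\cap(\mathbb R+I\mathbb R)$ has continuous derivatives and $\frac12\left(\frac{\partial}{\partial x}+I\frac{\partial}{\partial y}\right)f_I(x+Iy)=0$. A rank-4 lattice in $\mathbb H$ is the additive subgroup generated by four $\mathbb R$-linearly independent elements. A quaternionic torus is a quotient $T=\mathbb H/L$, $L$ a rank-4 lattice, with the atlas of local inverses of the projection $\pi:\mathbb H\to\mathbb H/L$ on small connected open sets. A map between two quaternionic tori is regular if its expressions in these charts are slice regular; a biregular diffeomorphism is a bijective regular map with regular inverse. Two tori are equivalent if there is a biregular diffeomorphism of one onto the other. For $T=\mathbb H/L$, $Aut(T)$ is the group (under composition) of maps $F(q)=qa$ with $a\in\mathbb S^3$ and $F(L)=L$. The Gram matrix of an (ordered) basis $\{v_1,v_2,v_3,v_4\}$ of a rank-4 lattice is $(\langle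 v_i,v_j\rangle)_{i,j}$. A Gram matrix $R=(r_{i,j})$ is reduced (in the sense of Minkowski–Siegel) if and only if: B1) $r_{k,k+1}\ge 0$ for $k=1,2,3$; B2) for each $k=1,2,3,4$, $n R\,{}^tn\ge r_{k,k}$ for every $n=(n_1,n_2,n_3,n_4)\in\mathbb Z^4$ such that $\gcd(n_k,\dots,n_4)=1$. A special basis is a basis whose Gram matrix is reduced and whose first element is $1$. $\mathcal M=\{(v_2,v_3,v_4)\in\mathbb H^3:\{1,v_2,v_3,v_4\}\text{ is a special basis}\}$. A triple $(v_2,v_3,v_4)$ is (a representative of) the modulus of $T$ if $(v_2,v_3,v_4)\in\mathcal M$ and $T$ is equivalent to $\mathbb H/(\mathbb Z+\mathbb Zv_2+\mathbb Zv_3+\mathbb Zv_4)$. $2C_2$ is the cyclic group of order $4$ generated in $\mathbb S^3$ by an element of $\mathbb S$ (it is isomorphic to the group $2D_2$ generated by $-1$ and an element $J\in\mathbb S$). *)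

(* Defs.v *)
From HB Require Import structures.
From mathcomp Require Import all_boot all_order all_algebra.
From mathcomp Require Import ring.
From mathcomp Require Import all_classical all_reals all_analysis.

Set Implicit Arguments.
Unset Strict Implicit.
Unset Printing Implicit Defensive.
Import Order.TTheory GRing.Theory Num.Theory.
Import numFieldNormedType.Exports.
Local Open Scope classical_set_scope.
Local Open Scope ring_scope.

(* Coordinates are taken in the basis 1, i, j, k. The norm `|q| inherited from
   row vectors is the max norm: it gives the Euclidean topology, but the
   Euclidean norm is [qnorm] below. *)

Definition quat (R : realType) : Type := 'rV[R]_4.
HB.instance Definition _ (R : realType) := NormedModule.copy (quat R) 'rV[R]_4.
HB.instance Definition _ (R : realType) := Vector.copy (quat R) 'rV[R]_4.

Section Quaternions.
Context {R : realType}.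
Implicit Types p q : quat R.

Definition mkquat (a b c d : R) : quat R := \row_(i < 4) [:: a; b; c; d]`_i.
Definition q0 q : R := q ord0 (@Ordinal 4 0 isT).
Definition q1 q : R := q ord0 (@Ordinal 4 1 isT).
Definition q2 q : R := q ord0 (@Ordinal 4 2 isT).
Definition q3 q : R := q ord0 (@Ordinal 4 3 isT).

Definition qone : quat R := mkquat 1 0 0 0.

Definition qmul p q : quat R := mkquat
  (q0 p * q0 q - q1 p * q1 q - q2 p * q2 q - q3 p * q3 q)
  (q0 p * q1 q + q1 p * q0 q + q2 p * q3 q - q3 p * q2 q)
  (q0 p * q2 q - q1 p * q3 q + q2 p * q0 q + q3 p * q1 q)
  (q0 p * q3 q + q1 p * q2 q - q2 p * q1 q + q3 p * q0 q).

Lemma quat_ext p q :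
  q0 p = q0 q -> q1 p = q1 q -> q2 p = q2 q -> q3 p = q3 q -> p = q.
Proof.
move=> h0 h1 h2 h3; apply/rowP => -[[|[|[|[|//]]]] lt_i];
  by [rewrite (bool_irrelevance lt_i isT)].
Qed.

Lemma q0E a b c d : q0 (mkquat a b c d) = a. Proof. by rewrite /q0 mxE. Qed.
Lemma q1E a b c d : q1 (mkquat a b c d) = b. Proof. by rewrite /q1 mxE. Qed.
Lemma q2E a b c d : q2 (mkquat a b c d) = c. Proof. by rewrite /q2 mxE. Qed.
Lemma q3E a b c d : q3 (mkquat a b c d) = d. Proof. by rewrite /q3 mxE. Qed.
Definition qE := (q0E, q1E, q2E, q3E).

Lemma q0D p q : q0 (p + q) = q0 p + q0 q. Proof. by rewrite /q0 mxE. Qed.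
Lemma q1D p q : q1 (p + q) = q1 p + q1 q. Proof. by rewrite /q1 mxE. Qed.
Lemma q2D p q : q2 (p + q) = q2 p + q2 q. Proof. by rewrite /q2 mxE. Qed.
Lemma q3D p q : q3 (p + q) = q3 p + q3 q. Proof. by rewrite /q3 mxE. Qed.
Definition qD := (q0D, q1D, q2D, q3D).

Lemma q0Z (a : R) q : q0 (a *: q) = a * q0 q. Proof. by rewrite /q0 mxE. Qed.
Lemma q1Z (a : R) q : q1 (a *: q) = a * q1 q. Proof. by rewrite /q1 mxE. Qed.
Lemma q2Z (a : R) q : q2 (a *: q) = a * q2 q. Proof. by rewrite /q2 mxE. Qed.
Lemma q3Z (a : R) q : q3 (a *: q) = a * q3 q. Proof. by rewrite /q3 mxE. Qed.
Definition qZ := (q0Z, q1Z, q2Z, q3Z).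

Lemma qmulA : associative qmul.
Proof. by move=> x y z; apply: quat_ext; rewrite !qE; ring. Qed.

Lemma qmul1l : left_id qone qmul.
Proof. by move=> x; apply: quat_ext; rewrite !qE; ring. Qed.

Lemma qmul1r : right_id qone qmul.
Proof. by move=> x; apply: quat_ext; rewrite !qE; ring. Qed.

Lemma qmulDl : left_distributive qmul +%R.
Proof. by move=> x y z; apply: quat_ext; rewrite !(qE, qD); ring. Qed.

Lemma qmulDr : right_distributive qmul +%R.
Proof. by move=> x y z; apply: quat_ext; rewrite !(qE, qD); ring. Qed.

Lemma qmulZl (a : R) p q : a *: qmul p q = qmul (a *: p) q.
Proof. by apply: quat_ext; rewrite !(qE, qZ); ring. Qed.

Lemma qmulZr (a : R) p q : a *: qmul p q = qmul p (a *: q).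
Proof. by apply: quat_ext; rewrite !(qE, qZ); ring. Qed.

Lemma qone_neq0 : qone != 0.
Proof.
apply/eqP => /(congr1 q0); rewrite qE /q0 mxE => /eqP.
by rewrite oner_eq0.
Qed.

End Quaternions.

HB.instance Definition _ (R : realType) := GRing.Zmodule_isNzRing.Build (quat R)
  qmulA qmul1l qmul1r qmulDl qmulDr qone_neq0.
HB.instance Definition _ (R : realType) :=
  GRing.Lmodule_isLalgebra.Build R (quat R) qmulZl.
HB.instance Definition _ (R : realType) :=
  GRing.Lalgebra_isAlgebra.Build R (quat R) qmulZr.

Section QuaternionGeometry.
Context {R : realType}.
Implicit Types p q : quat R.

Definition qdot p q : R := \sum_(i < 4) p ord0 i * q ord0 i.
Definition qnorm q : R := Num.sqrt (qdot q q).

Definition imag_units : set (quat R) := [set q | q ^+ 2 = -1].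
Definition S3 : set (quat R) := [set q | qnorm q = 1].

End QuaternionGeometry.

Section SliceRegular.
Context {R : realType}.
Implicit Types (Om : set (quat R)) (f : quat R -> quat R) (I : quat R).

Definition slice_restr f I (x y : R) : quat R := f (x%:A + y *: I).

Definition slice_dom Om I : set (R * R) :=
  [set z | Om (z.1%:A + z.2 *: I)].

Definition slice_dx f I (x y : R) : quat R :=
  derive1 (fun t : R => slice_restr f I t y) x.
Definition slice_dy f I (x y : R) : quat R :=
  derive1 (fun t : R => slice_restr f I x t) y.

(* [f] is total, but only its values on [Om] matter because [Om] is open. [Om]
   need not be connected, the conditions being local. *)
Definition slice_regular Om f : Prop :=
  open Om /\
  forall I, imag_units I ->
  [/\ forall x y : R, slice_dom Om I (x, y) ->
        derivable (fun t : R => slice_restr f I t y) x 1 /\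
        derivable (fun t : R => slice_restr f I x t) y 1,
      {within slice_dom Om I, continuous (fun z => slice_dx f I z.1 z.2)},
      {within slice_dom Om I, continuous (fun z => slice_dy f I z.1 z.2)} &
      forall x y : R, slice_dom Om I (x, y) ->
        (2^-1 : R) *: (slice_dx f I x y + I * slice_dy f I x y) = 0].

End SliceRegular.

Definition zspan {R : realType} (v : 4.-tuple (quat R)) : set (quat R) :=
  [set q | exists n : 'I_4 -> int, q = \sum_i tnth v i *~ n i].

Record lattice (R : realType) := Lattice {
  lattice_set :> set (quat R);
  latticeP : exists2 v : 4.-tuple (quat R), free v & lattice_set = zspan v }.

Section Torus.
Context {R : realType}.
Implicit Type L : lattice R.

Definition latrel L : rel (quat R) := fun x y => `[< lattice_set L (x - y) >].

Lemma lattice0 L : lattice_set L 0.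
Proof.
case: (latticeP L) => v _ ->; exists (fun=> 0).
by rewrite big1// => i _; rewrite mulr0z.
Qed.

Lemma latticeB L x y :
  lattice_set L x -> lattice_set L y -> lattice_set L (x - y).
Proof.
case: (latticeP L) => v _ -> [m ->] [n ->]; exists (fun i => m i - n i).
by rewrite -sumrB; apply: eq_bigr => i _; rewrite mulrzBr.
Qed.

Lemma latrel_refl L : reflexive (latrel L).
Proof. by move=> x; apply/asboolP; rewrite subrr; exact: lattice0. Qed.

Lemma latrel_sym L : symmetric (latrel L).
Proof.
have sub x y : latrel L x y -> latrel L y x.
  move=> /asboolP Lxy; apply/asboolP; rewrite -opprB -sub0r.
  by apply: latticeB => //; exact: lattice0.
by move=> x y; apply/idP/idP; exact: sub.
Qed.

Lemma latrel_trans L : transitive (latrel L).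
Proof.
move=> y x z /asboolP Lxy; rewrite latrel_sym => /asboolP Lzy; apply/asboolP.
have -> : x - z = (x - y) - (z - y) by rewrite opprB addrA subrK.
exact: latticeB.
Qed.

Canonical latrel_equiv L :=
  EquivRel (latrel L) (@latrel_refl L) (@latrel_sym L) (@latrel_trans L).

Definition torus L : Type := {eq_quot (latrel_equiv L)}%qT.

Definition torus_pi L (q : quat R) : torus L :=
  \pi_({eq_quot (latrel_equiv L)})%qT q.

Definition chart_dom L (U : set (quat R)) : Prop :=
  [/\ open U, connected U & {in U &, injective (torus_pi L)}].

(* On [torus_pi L @` U] this is the inverse of [torus_pi L] restricted to U. *)
Definition chart L (U : set (quat R)) : torus L -> quat R :=
  'pinv_(fun=> 0) U (torus_pi L).

End Torus.

Section RegularMaps.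
Context {R : realType}.
Implicit Types L M : lattice R.

(* As [slice_regular] requires its domain to be open, this includes the
   continuity of [F] for the quotient topologies. *)
Definition torus_regular L M (F : torus L -> torus M) : Prop :=
  forall U V, chart_dom L U -> chart_dom M V ->
    slice_regular (U `&` [set q | (torus_pi M @` V) (F (torus_pi L q))])
                  (chart V \o F \o torus_pi L).

Definition biregular L M (F : torus L -> torus M) : Prop :=
  torus_regular F /\
  exists G : torus M -> torus L, [/\ cancel F G, cancel G F & torus_regular G].

Definition tori_equivalent L M : Prop :=
  exists F : torus L -> torus M, biregular F.

(* The self-maps of H/L induced by q |-> qa. *)
Definition torus_aut L : set (torus L -> torus L) :=
  [set F | exists a : quat R,
    [/\ S3 a, (fun q => q * a) @` L = L &
        forall q, F (torus_pi L q) = torus_pi L (q * a)]].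

End RegularMaps.

Section Moduli.
Context {R : realType}.

Definition gram (v : 4.-tuple (quat R)) : 'M[R]_4 :=
  \matrix_(i, j) qdot (tnth v i) (tnth v j).

Definition int_form (A : 'M[R]_4) (n : 'rV[int]_4) : R :=
  let x : 'rV[R]_4 := map_mx intr n in (x *m A *m x^T) ord0 ord0.

(* Indices start at 0: r_{k,l} is [A (k-1) (l-1)]. *)
Definition reduced (A : 'M[R]_4) : Prop :=
  (forall k l : 'I_4, l = k.+1 :> nat -> 0 <= A k l) /\
  (forall (k : 'I_4) (n : 'rV[int]_4),
     \big[gcdn/0%N]_(i < 4 | (k <= i)%N) `|n ord0 i|%N = 1%N ->
     A k k <= int_form A n).

Definition special_basis (v : 4.-tuple (quat R)) : Prop :=
  [/\ free v, reduced (gram v) & tnth v ord0 = 1].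

Definition moduli_set : set (quat R * quat R * quat R) :=
  [set t | special_basis [tuple 1; t.1.1; t.1.2; t.2]].

Definition is_modulus (L : lattice R) (t : quat R * quat R * quat R) : Prop :=
  moduli_set t /\
  exists2 M : lattice R,
    M = zspan [tuple 1; t.1.1; t.1.2; t.2] :> set (quat R) &
    tori_equivalent L M.

End Moduli.

(* The subset G of M is a group for the (associative, unital) operation op. *)
Definition is_group (M : Type) (op : M -> M -> M) (e : M) (G : set M) : Prop :=
  [/\ G e,
      forall x y, G x -> G y -> G (op x y) &
      forall x, G x -> exists2 y, G y & op x y = e /\ op y x = e].

Definition group_isomorphic (M N : Type) (opM : M -> M -> M)
    (opN : N -> N -> N) (G : set M) (H : set N) : Prop :=
  exists2 phi : M -> N, set_bij G H phi &
    forall x y, G x -> G y -> phi (opM x y) = opN (phi x) (phi y).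

Section FiniteGroups.
Context {R : realType}.

Definition gen_S3 (X : set (quat R)) : set (quat R) :=
  smallest [set G | G `<=` S3 /\ is_group *%R 1 G] X.

Definition C2_2 (I : quat R) : set (quat R) := gen_S3 [set I].
Definition D2_2 (J : quat R) : set (quat R) := gen_S3 [set -1; J].

Definition aut_has_subgroup_iso (L : lattice R) (G : set (quat R)) : Prop :=
  exists H : set (torus L -> torus L),
    [/\ H `<=` torus_aut (L := L),
        is_group (@comp (torus L) (torus L) (torus L)) id H &
        group_isomorphic *%R (@comp (torus L) (torus L) (torus L)) G H].

End FiniteGroups.

(* Main.v *)
Require Import Defs.
From HB Require Import structures.
From mathcomp Require Import all_boot all_order all_algebra.
From mathcomp Require Import ring lra zify.
From mathcomp Require Import all_classical all_reals all_analysis.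
Set Implicit Arguments.
Unset Strict Implicit.
Unset Printing Implicit Defensive.
Import Order.TTheory GRing.Theory Num.Theory.
Import numFieldNormedType.Exports.
Local Open Scope classical_set_scope.
Local Open Scope ring_scope.

(** The two cyclic groups are the same set [{1, -1, I, -I}], up to the choice of
    the imaginary unit, so the statement is about right multiplications of order
    four: the torus H/L has a subgroup of automorphisms of this type if and only
    if [L * a = L] for some imaginary unit [a], and both implications go through
    this property of [L].

    From the property to the modulus.  Let [w] be a shortest nonzero vector of
    [L].  The lattice [L * w^-1] contains 1, its nonzero vectors have norm at
    least 1, and it is stable under right multiplication by
    [I = w * a * w^-1], so it is a right module over the Gaussian integers
    [Z + Z I].  A vector [al] that is shortest among those outside the plane
    [R + R I] completes 1 to a Gaussian basis: any other vector can be
    translated by Gaussian multiples of 1 and [al] until it is too short to lie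
    outside the plane.  This Euclidean division just fails when [al] has norm 1
    and is orthogonal to the plane (as happens in the Hurwitz order), and then
    another shortest vector, not orthogonal to the plane, has to be chosen
    instead ([off_plane_min], [normalized_gauss_basis]).  Minimality gives the
    reduction inequalities.

    From the modulus to the property.  The lattice spanned by
    [1, I, al, al * I] is stable under right multiplication by [I], and what has
    to be shown is that an equivalence of tori carries this back to [L].  This
    follows from the rigidity of regular maps, [torus_regular_affine]: a regular
    map between tori lifts to [q |-> c + q * a].  Liouville's
    theorem is applied to increments: for a small real number [h], the small
    vector [D h q] by which the image moves when [q] moves to [q + h] is well
    defined, bounded, and slice regular in [q], because real translations
    preserve every slice.  Liouville's theorem makes it constant on every slice,
    and all slices meet along the real axis, so [D h q] does not depend on [q]
    at all.  Its derivative at [h = 0] is then the common slice derivative of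
    all local lifts.

    Liouville's theorem itself, [bounded_Cauchy_Riemann_derive0], is proved for
    a pair of real functions with continuous partial derivatives by averaging
    [f (r e^it) e^-it] over circles, which yields a multiple of [r]
    that boundedness forces to vanish. *)

(** * Liouville's theorem for the Cauchy-Riemann system *)

Lemma MVT_dist (R : realType) (f df : R -> R) (x y : R) :
  (forall z : R, is_derive z 1 f (df z)) ->
  exists2 c, `|c - x| <= `|y - x| & f y - f x = df c * (y - x).
Proof.
move=> fdf.
have cf A : {within A, continuous f}.
  apply: continuous_subspaceT => z.
  by apply/differentiable_continuous/derivable1_diffP; exact: ex_derive.
have [xy|yx] := leP x y.
  have [c] := MVT_segment xy (fun z _ => fdf z) (cf _).
  rewrite in_itv/= => /andP[xc cy] fE; exists c => //.
  by rewrite !ger0_norm ?subr_ge0// lerD2r.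
have [c] := MVT_segment (ltW yx) (fun z _ => fdf z) (cf _).
rewrite in_itv/= => /andP[yc cx] fE; exists c.
  by rewrite !ler0_norm ?subr_le0//; [rewrite lerN2 lerD2r|exact: ltW].
by rewrite -opprB fE -mulrN opprB.
Qed.

Lemma is_derive1P (R : realType) (V : normedModType R) (f : R -> V) (t : R) (df : V) :
  h^-1 *: (f (h + t) - f t) @[h --> 0^'] --> df <-> is_derive t 1 f df.
Proof.
have E : (fun h => h^-1 *: ((f \o shift t) (h *: 1) - f t)) =
    (fun h => h^-1 *: (f (h + t) - f t)).
  by apply/funext => h /=; rewrite [_ *: 1]mulr1.
split=> [h|[]].
  apply: DeriveDef; rewrite /derivable /derive E; last exact/cvg_lim.
  by apply/cvg_ex; exists df.
by rewrite /derivable /derive E => + <-.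
Qed.

(** The increment splits into a move of the first variable, which the mean value
    theorem turns into a value of [ux] at a nearby point, and a move of the second
    variable alone, to which the one-variable chain rule applies. *)
Lemma is_derive_comp2 (R : realType) (u ux uy : R -> R -> R) (a b : R -> R)
    (t da db : R) :
  (forall x y : R, is_derive x 1 (u^~ y) (ux x y)) ->
  (forall x y : R, is_derive y 1 (u x) (uy x y)) ->
  continuous (fun z : R * R => ux z.1 z.2) ->
  is_derive t 1 a da -> is_derive t 1 b db ->
  is_derive t 1 (fun s => u (a s) (b s))
    (ux (a t) (b t) * da + uy (a t) (b t) * db).
Proof.
move=> dux duy cux ha hb.
have ca : {for t, continuous a}.
  by apply/differentiable_continuous/derivable1_diffP; exact: ex_derive.
have cb : {for t, continuous b}.
  by apply/differentiable_continuous/derivable1_diffP; exact: ex_derive.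
have -> : (fun s => u (a s) (b s)) =
    (fun s => u (a s) (b s) - u (a t) (b s)) + (u (a t) \o b).
  by apply/funext => s; rewrite [RHS]/= fctE subrK.
apply: is_deriveD.
(* Intermediate points of the mean value theorem, as a function of the time. *)
have /choice[xi xiP] : forall s, exists c,
    `|c - a t| <= `|a s - a t| /\
    u (a s) (b s) - u (a t) (b s) = ux c (b s) * (a s - a t).
  move=> s; have [c c1 c2] := MVT_dist (a t) (a s) (fun x => dux x (b s)).
  by exists c.
have cxi : xi s @[s --> t] --> a t.
  apply/cvgrPdist_le => e e0.
  have /cvgrPdist_le/(_ _ e0) := ca.
  apply: filterS => s; rewrite distrC => h; rewrite distrC.
  exact: le_trans (xiP s).1 h.
have cP : ux (xi s) (b s) @[s --> t] --> ux (a t) (b t).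
  have h : (xi s, b s) @[s --> t] --> (a t, b t) by exact: cvg_pair cxi cb.
  exact: cvg_comp h (cux (a t, b t)).
have {}cP : ux (xi (h + t)) (b (h + t)) @[h --> 0^'] --> ux (a t) (b t).
  apply: (@cvg_comp _ _ _ (fun h => h + t) (fun s => ux (xi s) (b s)) _ (nbhs t)) => //.
  have : (fun h : R => h + t) @ 0^' --> 0 + t.
    by apply: cvgD; [exact: cvg_within|exact: cvg_cst].
  by rewrite add0r.
have {}ha := (is_derive1P _ _ _).2 ha.
apply/is_derive1P.
rewrite mulrC.
rewrite [X in X @ _](_ : _ = fun h => (h^-1 *: (a (h + t) - a t)) *
    ux (xi (h + t)) (b (h + t))); first exact: cvgM ha cP.
by apply/funext => h; rewrite subrr subr0 (xiP _).2 -scalerAl [_ * ux _ _]mulrC.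
Qed.

Lemma continuous_integrable_segment (R : realType) (f : R -> R) (a b : R) :
  continuous f -> (@lebesgue_measure R).-integrable `[a, b] (EFin \o f).
Proof.
move=> cf; apply: continuous_compact_integrable; first exact: segment_compact.
exact: continuous_subspaceT.
Qed.

Lemma Rintegral_derive (R : realType) (F f : R -> R) (a b : R) : a < b ->
  continuous f -> (forall x : R, is_derive x 1 F (f x)) ->
  \int[lebesgue_measure]_(x in `[a, b]) f x = F b - F a.
Proof.
move=> ab cf dF.
have cF : continuous F.
  move=> x.
  by apply/differentiable_continuous/derivable1_diffP; exact: ex_derive.
rewrite /Rintegral (@continuous_FTC2 _ f F) ?EFinB//.
- exact: continuous_subspaceT.
- split; first by move=> x _; exact: ex_derive.
    by apply: cvg_at_right_filter; exact: cF.
  by apply: cvg_at_left_filter; exact: cF.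
- by move=> x _; rewrite derive1E derive_val.
Qed.

Section BoundedCauchyRiemann.
Variables (R : realType) (u v ux vx : R -> R -> R) (B : R).
Hypothesis dux : forall x y : R, is_derive x 1 (u^~ y) (ux x y).
Hypothesis duy : forall x y : R, is_derive y 1 (u x) (- vx x y).
Hypothesis dvx : forall x y : R, is_derive x 1 (v^~ y) (vx x y).
Hypothesis dvy : forall x y : R, is_derive y 1 (v x) (ux x y).
Hypothesis cux : continuous (fun z : R * R => ux z.1 z.2).
Hypothesis cvx : continuous (fun z : R * R => vx z.1 z.2).
Hypothesis uB : forall x y, `|u x y| <= B.
Hypothesis vB : forall x y, `|v x y| <= B.

(** For [f = u + i v], these are the real part and minus the imaginary part of
    [f (r e^it) e^-it]. *)
Let radial r t := u (r * cos t) (r * sin t) * cos t + v (r * cos t) (r * sin t) * sin t.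
Let angular r t := u (r * cos t) (r * sin t) * sin t - v (r * cos t) (r * sin t) * cos t.
Let uxpol r t := ux (r * cos t) (r * sin t).

Let d_rcos (r t : R) : is_derive t 1 (fun t : R => r * cos t) (- r * sin t).
Proof. by apply: is_derive_eq; rewrite /GRing.scale/=; ring. Qed.

Let d_rsin (r t : R) : is_derive t 1 (fun t : R => r * sin t) (r * cos t).
Proof. by apply: is_derive_eq; rewrite /GRing.scale/=; ring. Qed.

(** By holomorphy the radial derivative of [f (r e^it) e^-it] is [f' (r e^it)],
    whose real part is [ux]. *)
Let d_radial (r t : R) : is_derive r 1 (radial^~ t) (uxpol r t).
Proof.
have hc : is_derive r 1 (fun r : R => r * cos t) (cos t).
  by apply: is_derive_eq; rewrite /GRing.scale/=; ring.
have hs : is_derive r 1 (fun r : R => r * sin t) (sin t).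
  by apply: is_derive_eq; rewrite /GRing.scale/=; ring.
have hu := is_derive_comp2 dux duy cux hc hs.
have hv := is_derive_comp2 dvx dvy cvx hc hs.
apply: is_derive_eq.
rewrite /uxpol /GRing.scale/=.
rewrite -[RHS]mulr1 -(cos2Dsin2 t); ring.
Qed.

Let d_angular (r t : R) : is_derive t 1 (angular r) (radial r t - r * uxpol r t).
Proof.
have hu := is_derive_comp2 dux duy cux (d_rcos r t) (d_rsin r t).
have hv := is_derive_comp2 dvx dvy cvx (d_rcos r t) (d_rsin r t).
apply: is_derive_eq.
rewrite /uxpol /radial /GRing.scale/=.
rewrite -[r * ux _ _]mulr1 -(cos2Dsin2 t); ring.
Qed.

Let continuous_polar (f : R -> R -> R) r : continuous (fun z : R * R => f z.1 z.2) ->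
  continuous (fun t => f (r * cos t) (r * sin t)).
Proof.
move=> cf t.
have h : (r * cos s, r * sin s) @[s --> t] --> (r * cos t, r * sin t).
  have hc : r * cos s @[s --> t] --> r * cos t by apply: cvgMr; exact: continuous_cos.
  have hs : r * sin s @[s --> t] --> r * sin t by apply: cvgMr; exact: continuous_sin.
  exact: cvg_pair hc hs.
exact: cvg_comp h (cf _).
Qed.

Let continuous_uxpol r : continuous (uxpol r).
Proof. exact: continuous_polar. Qed.

Let continuous_polar_C1 (w wx wy : R -> R -> R) :
  (forall x y : R, is_derive x 1 (w^~ y) (wx x y)) ->
  (forall x y : R, is_derive y 1 (w x) (wy x y)) ->
  continuous (fun z : R * R => wx z.1 z.2) ->
  forall r, continuous (fun t => w (r * cos t) (r * sin t)).
Proof.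
move=> dwx dwy cwx r t.
have hw := is_derive_comp2 dwx dwy cwx (d_rcos r t) (d_rsin r t).
by apply/differentiable_continuous/derivable1_diffP; exact: ex_derive.
Qed.

Let continuous_radial r : continuous (radial r).
Proof.
move=> t; apply: cvgD; apply: cvgM.
- exact: continuous_polar_C1 dux duy cux r t.
- exact: continuous_cos.
- exact: continuous_polar_C1 dvx dvy cvx r t.
- exact: continuous_sin.
Qed.

Let p2 : R := pi *+ 2.
Let p2_gt0 : 0 < p2. Proof. by rewrite mulrn_wgt0// pi_gt0. Qed.

(** Integrals over the circle of radius [r] of the real parts of
    [f (r e^it) e^-it] and of [f' (r e^it)]; the latter is the derivative of the
    former. *)
Let H r := \int[lebesgue_measure]_(t in `[0, p2]) radial r t.
Let K r := \int[lebesgue_measure]_(t in `[0, p2]) uxpol r t.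

(** The angular derivative integrates to zero over a period: this is Cauchy's
    theorem in polar coordinates. *)
Let HK r : H r = r * K r.
Proof.
have cE : continuous (fun t => radial r t - r * uxpol r t).
  by move=> t; apply: cvgB; [exact: continuous_radial|apply: cvgMr; exact: continuous_uxpol].
have := Rintegral_derive p2_gt0 cE (d_angular r).
rewrite RintegralB//; last 2 first.
- exact: continuous_integrable_segment.
- by apply: continuous_integrable_segment => t; apply: cvgMr; exact: continuous_uxpol.
rewrite RintegralZl//; last exact: continuous_integrable_segment.
rewrite /angular cos2pi sin2pi cos0 sin0 !mulr0 !mulr1 subrr => /eqP.
by rewrite subr_eq0 => /eqP.
Unshelve. all: end_near. Qed.

Let bounded_uxpol (r : R) : exists M, forall s t, `|s| <= r -> `|uxpol s t| <= M.
Proof.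
have cK : compact (`[- r, r] `*` `[- r, r] : set (R * R)).
  by apply: compact_setX; exact: segment_compact.
have /compact_bounded[M [_ /(_ (M + 1))]] :=
  continuous_compact (continuous_subspaceT (A := _ `*` _) cux) cK.
rewrite ltrDl ltr01 => /(_ isT) hM; exists (M + 1) => s t sr.
have sr1 w : `|w| <= 1 -> - r <= s * w <= r.
  move=> w1; rewrite -ler_norml normrM -[r]mulr1.
  by apply: ler_pM => //; rewrite -(normr1 R).
apply: hM; exists (s * cos t, s * sin t) => //=.
by split=> /=; rewrite in_itv/= sr1 ?cos_max ?sin_max.
Qed.

Let dH (r : R) : is_derive r 1 H (K r).
Proof.
have [M hM] := bounded_uxpol (`|r| + 1).
have M0 : 0 <= M by apply: le_trans (normr_ge0 _) (hM 0 0 _); rewrite normr0 addr_ge0.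
have Ir : `](r - 1), (r + 1)[%classic r.
  by rewrite /= in_itv/= ltrBlDr ltrDl ltr01.
have i1 x : `](r - 1), (r + 1)[%classic x ->
    (@lebesgue_measure R).-integrable `[0, p2] (EFin \o radial x).
  by move=> _; exact: continuous_integrable_segment.
have i2 x y : `](r - 1), (r + 1)[%classic x -> `[0, p2]%classic y ->
   derivable (radial ^~ y) x 1.
  by move=> _ _; have ? := d_radial x y; exact: ex_derive.
have E x y : partial1of2 radial x y = uxpol x y.
  by rewrite partial1of2E; have ? := d_radial x y; rewrite derive_val.
have i3 : (@lebesgue_measure R).-integrable `[0, p2] (EFin \o cst M).
  by apply: continuous_integrable_segment; exact: cst_continuous.
have i4 x y : `](r - 1), (r + 1)[%classic x -> `[0, p2]%classic y ->
    `|partial1of2 radial x y| <= M.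
  rewrite /= in_itv/= => /andP[x1 x2] _; rewrite E; apply: hM.
  rewrite -[x](subrK r) addrC; apply: le_trans (ler_normD _ _) _.
  by rewrite lerD2l ler_norml; apply/andP; split; lra.
have hd := @derivable_under_integral R _ (measurableTypeR R) lebesgue_measure radial _ (measurable_itv `[0, p2]) _ _ _ Ir i1 i2 (cst M) (fun=> M0) i3 i4.
have := @differentiation_under_integral R _ (measurableTypeR R) lebesgue_measure radial _ (measurable_itv `[0, p2]) _ _ _ Ir i1 i2 (cst M) (fun=> M0) i3 i4.
rewrite derive1E => hE; apply: DeriveDef; first exact: hd.
rewrite hE; by apply: eq_Rintegral => t _; exact: E.
Qed.

Let p2_measure : fine (lebesgue_measure (`[0, p2]%classic : set R)) = p2.
Proof. by rewrite lebesgue_measure_itv/= lte_fin p2_gt0/= oppr0 addr0. Qed.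

Let H_bound r : `|H r| <= (B + B) * p2.
Proof.
apply: le_trans (le_normr_Rintegral _ _) _ => //.
  exact: continuous_integrable_segment.
have -> : (B + B) * p2 = \int[lebesgue_measure]_(t in `[0, p2]) (B + B).
  by rewrite (Rintegral_cst lebesgue_measure (measurable_itv `[0, p2])) p2_measure.
apply: le_Rintegral => //.
- apply: continuous_integrable_segment => t; apply: cvg_norm; exact: continuous_radial.
- by apply: continuous_integrable_segment; exact: cst_continuous.
move=> t _; apply: le_trans (ler_normD _ _) _; rewrite !normrM.
by apply: lerD; rewrite -[B]mulr1; apply: ler_pM => //; rewrite ?cos_max ?sin_max.
Qed.

(** The equation [H r = r * H' r] makes [H] proportional to [r] for positive
    [r].  The substitution [r = exp s] turns this into a vanishing derivative on
    the whole line, and boundedness forces the slope to be zero. *)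
Let Hexp s : H (expR s) = 0.
Proof.
have dg (x : R) : is_derive x 1 (fun x => H (expR x) * expR (- x)) 0.
  have h1 : is_derive x 1 (fun x : R => H (expR x)) (K (expR x) * expR x).
    exact: (@is_derive1_comp R H expR).
  have h2 : is_derive x 1 (fun x : R => expR (- x)) (- expR (- x)).
    apply: is_derive_eq (@is_derive1_comp R expR -%R x _ _ _ _) _.
    by rewrite mulrN1.
  apply: is_derive_eq; rewrite /GRing.scale/= HK; ring.
have gE x : H (expR x) * expR (- x) = H (expR s) * expR (- s).
  exact: (is_derive_0_is_cst _ _ dg).
apply/eqP; rewrite -normr_eq0 -[_ == _]negbK -normr_gt0 normr_id; apply/negP => h.
set c := H (expR s) * expR (- s) in gE.
have c0 : 0 < `|c| by rewrite normrM mulr_gt0// normr_gt0 gt_eqF ?expR_gt0.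
pose x := (B + B) * p2 / `|c|.
have := H_bound (expR x).
have -> : H (expR x) = c * expR x.
  by rewrite -(gE x) -mulrA [expR (- x) * _]mulrC expRxMexpNx_1 mulr1.
have -> : (B + B) * p2 = `|c| * x by rewrite [RHS]mulrC /x divfK ?gt_eqF.
rewrite normrM (ger0_norm (expR_ge0 _)) leNgt => /negP; apply.
by rewrite ltr_pM2l// (lt_le_trans _ (expR_ge1Dx x))// ltrDr.
Qed.

(** Up to the factor [2 pi], [ux 0 0] is the integral of [ux] over the circle of
    radius 0, that is the derivative at 0 of [H], which vanishes for positive
    radii. *)
Lemma bounded_Cauchy_Riemann_derive0 : ux 0 0 = 0.
Proof.
have Hpos r : 0 < r -> H r = 0 by move=> r0; rewrite -[r]lnK ?posrE// Hexp.
have H0 : H 0 = 0 by rewrite HK mul0r.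
have : K 0 = 0.
  have /is_derive1P/cvg_dnbhs_at_right h := dH 0.
  apply: (cvg_unique _ h) => //; apply: cvg_near_cst.
  have : \forall r \near 0^'+, 0 < r :> R by exact: nbhs_right_gt.
  by apply: filterS => r r0; rewrite addr0 H0 Hpos// subrr scaler0.
have -> : K 0 = \int[lebesgue_measure]_(t in `[0, p2]) ux 0 0.
  by apply: eq_Rintegral => t _; rewrite /uxpol !mul0r.
rewrite (Rintegral_cst lebesgue_measure (measurable_itv `[0, p2])) p2_measure => /eqP.
by rewrite mulf_eq0 (gt_eqF p2_gt0) orbF => /eqP.
Unshelve. all: end_near. Qed.

End BoundedCauchyRiemann.
(** * Bounded regular functions on a slice *)

Lemma ler_norm_coord (R : realType) (q : quat R) i : `|q ord0 i| <= `|q|.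
Proof.
rewrite [leRHS]/Num.norm /= mx_normrE.
exact: (le_bigmax 0 (fun k : 'I_1 * 'I_4 => `|q k.1 k.2|) (ord0, i)).
Qed.

Lemma ler_norm_quat (R : realType) (q : quat R) (e : R) : 0 <= e ->
  (forall i, `|q ord0 i| <= e) -> `|q| <= e.
Proof.
move=> e0 h; rewrite [leLHS]/Num.norm /= mx_normrE.
by apply/bigmax_leP; split=> // -[k i] _; rewrite ord1.
Qed.

Lemma linear_quat_sum (R : realType) (V : lmodType R) (f : quat R -> V) :
  linear f -> forall q, f q = \sum_i q ord0 i *: f (delta_mx ord0 i).
Proof.
move=> lf q.
pose g : {linear quat R -> V} :=
  HB.pack f (GRing.isLinear.Build R (quat R) V _ f lf).
rewrite -[f]/(g : _ -> _) {1}[q](row_sum_delta q) linear_sum.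
by apply: eq_bigr => i _; rewrite linearZ.
Qed.

Lemma quat_coord_continuous (R : realType) (i : 'I_4) :
  continuous (fun q : quat R => q ord0 i).
Proof. exact: coord_continuous. Qed.

Lemma linear_quat_continuous (R : realType) (V : normedModType R)
  (f : quat R -> V) : linear f -> continuous f.
Proof.
move=> lf; rewrite (_ : f = fun q => \sum_i q ord0 i *: f (delta_mx ord0 i)).
  apply: continuous_big => [|i _ q]; first exact: add_continuous.
  by have h := @quat_coord_continuous R i q; exact: cvgZr_tmp h.
by apply/funext; exact: linear_quat_sum.
Qed.

Lemma linear_quat_bounded (R : realType) (V : normedModType R)
  (f : quat R -> V) : linear f -> exists2 C, 0 < C & forall q, `|f q| <= C * `|q|.
Proof.
move=> lf; exists (1 + \sum_i `|f (delta_mx ord0 i)|).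
  by rewrite ltr_pwDl// sumr_ge0.
move=> q; rewrite (linear_quat_sum lf) mulrDl mul1r.
apply: le_trans (ler_norm_sum _ _ _) _; rewrite -[leLHS]add0r lerD// mulr_suml.
apply: ler_sum => i _; rewrite normrZ mulrC; apply: ler_wpM2l => //.
exact: ler_norm_coord.
Qed.

Lemma is_derive_linear_quat (R : realType) (V : normedModType R)
  (f : quat R -> V) (g : R -> quat R) (t : R) dg : linear f ->
  is_derive t 1 g dg -> is_derive t 1 (f \o g) (f dg).
Proof.
move=> lf /is_derive1P h; apply/is_derive1P.
pose f' : {linear quat R -> V} :=
  HB.pack f (GRing.isLinear.Build R (quat R) V _ f lf).
rewrite [X in X @ _](_ : _ = fun h => f (h^-1 *: (g (h + t) - g t))).
  exact: (continuous_cvg _ (linear_quat_continuous lf (x := dg)) h).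
apply/funext => k; rewrite -[f]/(f' : _ -> _).
by rewrite [RHS]linearZ; congr (_ *: _); rewrite [RHS]linearB.
Qed.

Lemma linear_coord (R : realType) (i : 'I_4) :
  linear (fun q : quat R => q ord0 i).
Proof. by move=> a p q; rewrite !mxE. Qed.

Lemma imag_unitsM (R : realType) (I q : quat R) : imag_units I ->
  I * (I * q) = - q.
Proof. by move=> I2; rewrite mulrA -expr2 I2 mulN1r. Qed.

(** Every real-linear form [la] gives a pair [la], [q |-> - la (I * q)] along which
    the equation on the slice becomes the classical Cauchy-Riemann system; the
    coordinate forms suffice to detect zero. *)
Lemma bounded_slice_derive0 (R : realType) (I : quat R) (D Dx Dy : R -> R -> quat R)
    (B : R) : imag_units I ->
  (forall x y : R, is_derive x 1 (D^~ y) (Dx x y)) ->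
  (forall x y : R, is_derive y 1 (D x) (Dy x y)) ->
  (forall x y, Dx x y + I * Dy x y = 0) ->
  continuous (fun z : R * R => Dx z.1 z.2) ->
  (forall x y, `|D x y| <= B) -> forall x y, Dx x y = 0.
Proof.
move=> II dDx dDy CR cDx DB x0 y0; apply/rowP => i; rewrite mxE.
have DyE x y : Dy x y = I * Dx x y.
  have /eqP := CR x y; rewrite addr_eq0 => /eqP ->.
  by rewrite mulrN (imag_unitsM _ II) opprK.
pose la (q : quat R) := q ord0 i.
pose mu (q : quat R) := - (I * q) ord0 i.
have lla : linear la by exact: linear_coord.
have lmu : linear mu.
  by move=> a p q; rewrite /mu mulrDr -scalerAr !mxE opprD scalerN.
have mula q : mu (I * q) = la q.
  by rewrite /mu (imag_unitsM _ II) /la !mxE opprK.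
have laI q : la (I * q) = - mu q by rewrite /mu /la opprK.
have [C C0 muC] := linear_quat_bounded lmu.
have dshift (s c : R) : is_derive s 1 (fun t : R => t + c) 1.
  by apply: is_derive_eq; rewrite addr0.
have shiftx (f : quat R -> R) : linear f -> forall x y : R,
    is_derive x 1 (fun x => f (D (x + x0) (y + y0))) (f (Dx (x + x0) (y + y0))).
  move=> lf x y.
  have h := is_derive_linear_quat lf (dDx (x + x0) (y + y0)).
  have := @is_derive1_comp R (f \o D^~ (y + y0)) (fun t : R => t + x0) x _ _ h (dshift x x0).
  by rewrite mulr1.
have shifty (f : quat R -> R) : linear f -> forall x y : R,
    is_derive y 1 (fun y => f (D (x + x0) (y + y0))) (f (Dy (x + x0) (y + y0))).
  move=> lf x y.
  have h := is_derive_linear_quat lf (dDy (x + x0) (y + y0)).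
  have := @is_derive1_comp R (f \o D (x + x0)) (fun t : R => t + y0) y _ _ h (dshift y y0).
  by rewrite mulr1.
have cshift (f : quat R -> R) : linear f ->
    continuous (fun z : R * R => f (Dx (z.1 + x0) (z.2 + y0))).
  move=> lf z.
  have h1 : (w.1 + x0) @[w --> z] --> z.1 + x0.
    by apply: cvgD; [exact: cvg_fst|exact: cvg_cst].
  have h2 : (w.2 + y0) @[w --> z] --> z.2 + y0.
    by apply: cvgD; [exact: cvg_snd|exact: cvg_cst].
  have h3 : (w.1 + x0, w.2 + y0) @[w --> z] --> (z.1 + x0, z.2 + y0).
    exact: cvg_pair h1 h2.
  have h4 := cvg_comp _ _ h3 (cDx _).
  exact: (continuous_cvg _ (linear_quat_continuous lf (x := _)) h4).
have := @bounded_Cauchy_Riemann_derive0 R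
  (fun x y => la (D (x + x0) (y + y0))) (fun x y => mu (D (x + x0) (y + y0)))
  (fun x y => la (Dx (x + x0) (y + y0))) (fun x y => mu (Dx (x + x0) (y + y0)))
  (Num.max B (C * B)).
rewrite !add0r; apply.
- exact: shiftx.
- by move=> x y; apply: is_derive_eq (shifty _ lla x y) _; rewrite DyE laI.
- exact: shiftx.
- by move=> x y; apply: is_derive_eq (shifty _ lmu x y) _; rewrite DyE mula.
- exact: cshift.
- exact: cshift.
- move=> x y; rewrite le_max; apply/orP; left.
  exact: le_trans (ler_norm_coord _ _) (DB _ _).
- move=> x y; rewrite le_max; apply/orP; right.
  by apply: le_trans (muC _) _; rewrite ler_pM2l.
Qed.

Lemma is_derive0_quat_cst (R : realType) (g : R -> quat R) :
  (forall t : R, is_derive t 1 g 0) -> forall s t, g s = g t.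
Proof.
move=> dg s t; apply/rowP => i.
apply: (is_derive_0_is_cst (f := fun t => g t ord0 i)) => x.
apply: is_derive_eq (is_derive_linear_quat (@linear_coord R i) (dg x)) _.
by rewrite mxE.
Qed.
(** * Quaternions in coordinates *)

Section QuaternionCoordinates.
Variable R : realType.
Implicit Types p q I : quat R.

Lemma q0M p q : q0 (p * q) = q0 p * q0 q - q1 p * q1 q - q2 p * q2 q - q3 p * q3 q.
Proof. exact: q0E. Qed.
Lemma q1M p q : q1 (p * q) = q0 p * q1 q + q1 p * q0 q + q2 p * q3 q - q3 p * q2 q.
Proof. exact: q1E. Qed.
Lemma q2M p q : q2 (p * q) = q0 p * q2 q - q1 p * q3 q + q2 p * q0 q + q3 p * q1 q.
Proof. exact: q2E. Qed.
Lemma q3M p q : q3 (p * q) = q0 p * q3 q + q1 p * q2 q - q2 p * q1 q + q3 p * q0 q.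
Proof. exact: q3E. Qed.
Lemma q01 : q0 (1 : quat R) = 1. Proof. exact: q0E. Qed.
Lemma q11 : q1 (1 : quat R) = 0. Proof. exact: q1E. Qed.
Lemma q21 : q2 (1 : quat R) = 0. Proof. exact: q2E. Qed.
Lemma q31 : q3 (1 : quat R) = 0. Proof. exact: q3E. Qed.
Lemma q0N q : q0 (- q) = - q0 q. Proof. by rewrite /q0 mxE. Qed.
Lemma q1N q : q1 (- q) = - q1 q. Proof. by rewrite /q1 mxE. Qed.
Lemma q2N q : q2 (- q) = - q2 q. Proof. by rewrite /q2 mxE. Qed.
Lemma q3N q : q3 (- q) = - q3 q. Proof. by rewrite /q3 mxE. Qed.
Lemma q00 : q0 (0 : quat R) = 0. Proof. by rewrite /q0 mxE. Qed.
Lemma q10 : q1 (0 : quat R) = 0. Proof. by rewrite /q1 mxE. Qed.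
Lemma q20 : q2 (0 : quat R) = 0. Proof. by rewrite /q2 mxE. Qed.
Lemma q30 : q3 (0 : quat R) = 0. Proof. by rewrite /q3 mxE. Qed.

Definition qcoord := (@qE R, @qD R, @qZ R, (q0M, q1M, q2M, q3M), (q01, q11, q21, q31),
  (q0N, q1N, q2N, q3N), (q00, q10, q20, q30)).

Lemma qdotE p q : qdot p q = q0 p * q0 q + q1 p * q1 q + q2 p * q2 q + q3 p * q3 q.
Proof.
rewrite /qdot !big_ord_recr big_ord0/= add0r.
by congr (_ * _ + _ * _ + _ * _ + _ * _); congr (_ _ _); exact: val_inj.
Qed.

Definition qnorm2 q := qdot q q.

Lemma qnorm2E q : qnorm2 q = q0 q ^+ 2 + q1 q ^+ 2 + q2 q ^+ 2 + q3 q ^+ 2.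
Proof. by rewrite /qnorm2 qdotE !expr2. Qed.

Lemma qnorm2_ge0 q : 0 <= qnorm2 q.
Proof. by rewrite qnorm2E !addr_ge0 ?sqr_ge0. Qed.

Lemma qnorm2_eq0 q : (qnorm2 q == 0) = (q == 0).
Proof.
apply/eqP/eqP => [|->]; last by rewrite qnorm2E !qcoord; ring.
rewrite qnorm2E => h; apply: quat_ext; rewrite !qcoord;
  apply/eqP; rewrite -sqrf_eq0; apply/eqP;
  have := sqr_ge0 (q0 q); have := sqr_ge0 (q1 q);
  have := sqr_ge0 (q2 q); have := sqr_ge0 (q3 q); lra.
Qed.

Lemma qnorm2_gt0 q : (0 < qnorm2 q) = (q != 0).
Proof. by rewrite lt_def qnorm2_eq0 qnorm2_ge0 andbT. Qed.

Lemma qnorm2M p q : qnorm2 (p * q) = qnorm2 p * qnorm2 q.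
Proof. by rewrite !qnorm2E !qcoord; ring. Qed.

Lemma qnorm2N q : qnorm2 (- q) = qnorm2 q.
Proof. by rewrite !qnorm2E !qcoord; ring. Qed.

Lemma qnorm21 : qnorm2 1 = 1.
Proof. by rewrite !qnorm2E !qcoord; ring. Qed.

Definition qinv q : quat R :=
  (qnorm2 q)^-1 *: mkquat (q0 q) (- q1 q) (- q2 q) (- q3 q).

Lemma qmulV q : q != 0 -> q * qinv q = 1.
Proof.
rewrite -qnorm2_eq0 => q0; apply: quat_ext; rewrite !qcoord; last 3 first.
- by ring.
- by ring.
- by ring.
by rewrite -(mulVf q0) qnorm2E; ring.
Qed.

Lemma qmulVl q : q != 0 -> qinv q * q = 1.
Proof.
rewrite -qnorm2_eq0 => q0; apply: quat_ext; rewrite !qcoord; last 3 first.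
- by ring.
- by ring.
- by ring.
by rewrite -(mulVf q0) qnorm2E; ring.
Qed.

Lemma qmul_eq0 p q : (p * q == 0) = (p == 0) || (q == 0).
Proof. by rewrite -!qnorm2_eq0 qnorm2M mulf_eq0. Qed.

Lemma qinv_neq0 q : q != 0 -> qinv q != 0.
Proof.
move=> /qmulV h; apply/eqP => e; move: h; rewrite e mulr0 => /eqP.
by rewrite eq_sym oner_eq0.
Qed.

Lemma imag_unitsP I : imag_units I <-> q0 I = 0 /\ q1 I ^+ 2 + q2 I ^+ 2 + q3 I ^+ 2 = 1.
Proof.
rewrite /imag_units/= expr2; split=> [h|[h0 h1]]; last first.
  apply: quat_ext; rewrite !qcoord h0; try ring.
  by rewrite -h1; ring.
have e0 := congr1 q0 h; have e1 := congr1 q1 h.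
have e2 := congr1 q2 h; have e3 := congr1 q3 h.
move: e0 e1 e2 e3; rewrite !qcoord => e0 e1 e2 e3.
have I0 : q0 I = 0.
  apply/eqP; case: (eqVneq (q0 I) 0) => // I0.
  have z x : q0 I * x + x * q0 I = 0 -> x = 0.
    move=> hx; apply: (mulfI I0); rewrite mulr0; lra.
  have z1 : q1 I = 0 by apply: z; lra.
  have z2 : q2 I = 0 by apply: z; lra.
  have z3 : q3 I = 0 by apply: z; lra.
  move: e0; rewrite z1 z2 z3 !mul0r !subr0 => e0.
  by have := sqr_ge0 (q0 I); rewrite expr2 e0 ler0N1.
by split=> //; move: e0; rewrite I0 !expr2; lra.
Qed.

Lemma qnorm2_imag I : imag_units I -> qnorm2 I = 1.
Proof. by move=> /imag_unitsP[I0 I1]; rewrite qnorm2E I0 -[RHS]I1; ring. Qed.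

Lemma S3P q : S3 q <-> qnorm2 q = 1.
Proof.
rewrite /S3/= /qnorm -/(qnorm2 q); split=> [h|->]; last exact: sqrtr1.
by rewrite -(sqr_sqrtr (qnorm2_ge0 q)) h expr1n.
Qed.

(** Completing the squares exhibits, as the coefficient of [a ^+ 2 + b ^+ 2], the
    squared norm of the component of [al] orthogonal to the plane of [I].  The
    first two squares are the part that translations by [Z + Z I] can reduce. *)
Lemma qnorm2_basis I al (x y a b : R) : imag_units I ->
  qnorm2 (x%:A + y *: I + al * (a%:A + b *: I)) =
  (x + a * q0 al - b * qdot al I) ^+ 2 + (y + a * qdot al I + b * q0 al) ^+ 2 +
  (qnorm2 al - q0 al ^+ 2 - qdot al I ^+ 2) * (a ^+ 2 + b ^+ 2).
Proof.
move=> /imag_unitsP[I0 I1].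
rewrite !qnorm2E !qdotE !qcoord I0.
set i := q1 I in I1 *; set j := q2 I in I1 *; set k := q3 I in I1 *.
set s := q0 al; set t1 := q1 al; set t2 := q2 al; set t3 := q3 al.
pose n := i ^+ 2 + j ^+ 2 + k ^+ 2.
pose t := t1 * i + t2 * j + t3 * k.
transitivity (x ^+ 2 + y ^+ 2 * n + 2 * (x * (a * s - b * t) + y * (a * t + b * n * s))
  + (s ^+ 2 + t1 ^+ 2 + t2 ^+ 2 + t3 ^+ 2) * (a ^+ 2 + b ^+ 2 * n)).
  by rewrite /n /t; ring.
by rewrite /n I1 /t; ring.
Qed.

Lemma ler_norm_qnorm2 q : `|q| ^+ 2 <= qnorm2 q.
Proof.
have h : `|q| <= Num.sqrt (qnorm2 q).
  apply: ler_norm_quat => [|i]; first exact: sqrtr_ge0.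
  rewrite -sqrtr_sqr ler_sqrt ?qnorm2_ge0// /qnorm2 /qdot (bigD1 i)//= expr2 lerDl.
  by apply: sumr_ge0 => j _; rewrite -expr2 sqr_ge0.
by rewrite -[leRHS](sqr_sqrtr (qnorm2_ge0 q)) ler_sqr ?nnegrE ?sqrtr_ge0.
Qed.

End QuaternionCoordinates.

(** * Discreteness of lattices *)

Section LatticeGeometry.
Variable R : realType.
Implicit Types (L M : lattice R) (v : 4.-tuple (quat R)).

Lemma free_coordinates v : free v -> exists2 c : 'I_4 -> quat R -> R,
  (forall q, q = \sum_i c i q *: tnth v i) &
  exists2 C, 0 < C & forall i q, `|c i q| <= C * `|q|.
Proof.
move=> fv; exists (fun i => coord v i).
  move=> q; have /coord_span : q \in <<v>>%VS.
    suff /span_basis -> : basis_of fullv v by rewrite memvf.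
    by rewrite basisEfree fv subvf/= dimvf /dim/= size_tuple.
  by move=> h; rewrite [LHS]h; apply: eq_bigr => i _; rewrite (tnth_nth 0).
have h i : exists C, 0 < C /\ forall q, `|coord v i q| <= C * `|q|.
  have [a p q|C C0 hC] := @linear_quat_bounded R R (coord v i).
    by rewrite linearP.
  by exists C.
have [C hC] := choice h.
exists (\sum_i C i).
  rewrite (bigD1 ord0)//= ltr_pwDl ?(hC _).1// sumr_ge0// => i _.
  by rewrite ltW// (hC _).1.
move=> i q; apply: le_trans ((hC i).2 q) _; apply: ler_wpM2r => //.
by rewrite (bigD1 i)//= lerDl sumr_ge0// => j _; rewrite ltW// (hC _).1.
Qed.

Lemma free_inj v (c d : 'I_4 -> R) : free v ->
  \sum_i c i *: tnth v i = \sum_i d i *: tnth v i -> forall i, c i = d i.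
Proof.
move=> /freeP fv /eqP; rewrite -subr_eq0 -sumrB => /eqP h i.
apply/eqP; rewrite -subr_eq0; apply/eqP; apply: (fv (fun i => c i - d i)).
apply: etrans h; apply: eq_bigr => j _.
by rewrite scalerBl (tnth_nth 0).
Qed.

Lemma latticeN L x : lattice_set L x -> lattice_set L (- x).
Proof. by move=> Lx; rewrite -sub0r; apply: latticeB => //; exact: lattice0. Qed.

Lemma latticeD L x y : lattice_set L x -> lattice_set L y -> lattice_set L (x + y).
Proof. by move=> Lx Ly; rewrite -[y]opprK; apply: latticeB => //; exact: latticeN. Qed.

Lemma latticeMz L x (n : int) : lattice_set L x -> lattice_set L (x *~ n).
Proof.
move=> Lx; have hn (m : nat) : lattice_set L (x *+ m).
  by elim: m => [|m IH]; [exact: lattice0|rewrite mulrS; exact: latticeD].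
by case: n => m; [exact: hn|rewrite NegzE mulrNz; exact/latticeN/hn].
Qed.

Lemma lattice_sum L v (n : 'I_4 -> int) : (forall i, lattice_set L (tnth v i)) ->
  lattice_set L (\sum_i tnth v i *~ n i).
Proof.
move=> hv; elim/big_ind: _ => [|x y|i _]; [exact: lattice0|exact: latticeD|].
exact: latticeMz.
Qed.

Lemma zspan_tnth v i : zspan v (tnth v i).
Proof.
exists (fun j => (j == i)%:Z); rewrite (bigD1 i)//= eqxx mulr1z big1 ?addr0// => j ji.
by rewrite (negbTE ji) mulr0z.
Qed.

Lemma lattice_discrete L :
  exists2 e : R, 0 < e & forall q, lattice_set L q -> q != 0 -> e <= `|q|.
Proof.
have [v fv Lv] := latticeP L.
have [c cE [C C0 hC]] := free_coordinates fv.
exists C^-1; first by rewrite invr_gt0.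
move=> q; rewrite Lv => -[n qE] q0.
have cn i : c i q = (n i)%:~R.
  apply: (free_inj (c := c^~ q) (d := fun i => (n i)%:~R) fv).
  by rewrite -cE qE; apply: eq_bigr => j _; rewrite scaler_int.
have [i ni] : exists i, n i != 0.
  apply: contrapT => h; move: q0; rewrite qE big1 ?eqxx// => i _.
  have [->|ni] := eqVneq (n i) 0; first by rewrite mulr0z.
  by exfalso; apply: h; exists i.
rewrite -[C^-1]mulr1 ler_pdivrMl//; apply: le_trans (hC i q).
by rewrite cn -intr_norm ler1z -gtz0_ge1 normr_gt0.
Qed.

(** The coordinates of a vector are bounded in terms of its norm, so the vectors
    of the lattice that are not longer than a given one lie in a finite box. *)
Lemma lattice_exists_min L (S : set (quat R)) : S `<=` L -> S !=set0 ->
  exists2 x, S x & forall y, S y -> qnorm2 x <= qnorm2 y.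
Proof.
move=> SL [x0 Sx0].
have [v fv Lv] := latticeP L.
have [c cE [C C0 hC]] := free_coordinates fv.
pose r := Num.sqrt (qnorm2 x0).
have [N hN] : exists N : nat, C * r <= N%:R.
  exists (Num.bound (C * r)); apply/ltW.
  by apply: le_lt_trans (archi_boundP _); rewrite ?mulr_ge0 ?sqrtr_ge0// ltW.
pose g (k : {ffun 'I_4 -> 'I_(N.*2.+1)}) : quat R :=
  \sum_i tnth v i *~ ((k i)%:Z - N%:Z).
have gS y : S y -> qnorm2 y <= qnorm2 x0 -> exists k, y = g k.
  move=> Sy yx; have := SL _ Sy; rewrite Lv => -[n yE].
  have cn i : c i y = (n i)%:~R.
    apply: (free_inj (c := c^~ y) (d := fun i => (n i)%:~R) fv).
    by rewrite -cE yE; apply: eq_bigr => j _; rewrite scaler_int.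
  have nN i : `|n i| <= N%:Z.
    rewrite -(ler_int R) intr_norm -cn; apply: le_trans (hC i y) _.
    apply: le_trans hN; rewrite ler_pM2l//.
    rewrite -ler_sqr ?nnegrE ?sqrtr_ge0//.
    by rewrite sqr_sqrtr ?qnorm2_ge0// (le_trans (ler_norm_qnorm2 _)).
  exists [ffun i => inord (absz (n i + N%:Z))].
  rewrite yE; apply: eq_bigr => i _; congr (_ *~ _); rewrite ffunE.
  have := nN i; rewrite ler_norml => /andP[n1 n2].
  rewrite inordK; last by lia.
  by lia.
have [k0 k0E] := gS _ Sx0 (lexx _).
pose P k := `[< S (g k) >].
have Pk0 : P k0 by apply/asboolP; rewrite -k0E.
case: (@arg_minP _ _ _ k0 P (fun k => qnorm2 (g k)) Pk0) => k /asboolP Sk kmin.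
exists (g k) => // y Sy.
have [yx|/ltW xy] := leP (qnorm2 y) (qnorm2 x0); last first.
  by apply: le_trans xy; rewrite k0E; exact: kmin.
by have [k' yE] := gS _ Sy yx; rewrite yE; apply: kmin; apply/asboolP; rewrite -yE.
Qed.

Lemma lattice_cobounded L : exists r : R, forall q, exists2 l, lattice_set L l & `|q - l| <= r.
Proof.
have [v fv Lv] := latticeP L.
have [c cE _] := free_coordinates fv.
exists (\sum_i `|tnth v i|) => q.
exists (\sum_i tnth v i *~ Num.floor (c i q)).
  by rewrite Lv; exists (fun i => Num.floor (c i q)).
rewrite {1}(cE q) -sumrB; apply: le_trans (ler_norm_sum _ _ _) _.
apply: ler_sum => i _; rewrite -scaler_int -scalerBl normrZ.
rewrite -[leRHS]mul1r; apply: ler_wpM2r => //.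
have /andP[h1 h2] := real_floor_itv (num_real (c i q)).
by rewrite ger0_norm ?subr_ge0// lerBlDl -intrD1 ltW.
Qed.

End LatticeGeometry.
(** * Charts of a torus *)

Section TorusProjection.
Variable R : realType.
Implicit Types (L M : lattice R).

Lemma torus_piP L (x y : quat R) :
  torus_pi L x = torus_pi L y <-> lattice_set L (x - y).
Proof.
split=> [/eqquotP/asboolP//|h].
by apply/eqquotP/asboolP.
Qed.

Lemma torus_pi_surj L (t : torus L) : exists x, torus_pi L x = t.
Proof. by exists (repr t); exact: reprK. Qed.

Lemma torus_piD L (x y z : quat R) :
  torus_pi L x = torus_pi L y -> torus_pi L (x + z) = torus_pi L (y + z).
Proof. by move=> /torus_piP h; apply/torus_piP; rewrite opprD addrACA subrr addr0. Qed.

Lemma torus_piDl L (x l : quat R) :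
  lattice_set L l -> torus_pi L (x + l) = torus_pi L x.
Proof. by move=> Ll; apply/torus_piP; rewrite addrAC subrr add0r. Qed.

Definition separated_by L (e : R) := forall l, lattice_set L l -> `|l| < e -> l = 0.

Lemma lattice_separated L : exists2 e : R, 0 < e & separated_by L e.
Proof.
have [e e0 h] := lattice_discrete L; exists e => // l Ll le.
by apply/eqP; apply: contraTT le => /(h _ Ll); rewrite leNgt.
Qed.

Lemma connected_quat_ball (p : quat R) (e : R) : connected (ball p e).
Proof.
have [e0|e0] := ltP 0 e; last first.
  rewrite (_ : ball p e = set0); first exact: connected0.
  apply/seteqP; split=> // x; rewrite -ball_normE/= => h.
  by have := le_lt_trans (normr_ge0 _) h; rewrite ltNge e0.
(* A ball is a union of segments issued from its centre. *)
pose seg (x : quat R) := (fun t : R => p + t *: (x - p)) @` `[0, 1].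
have -> : ball p e = \bigcup_(x in ball p e) seg x.
  apply/seteqP; split=> x; rewrite -ball_normE.
    move=> px; exists x => //; exists 1; first by rewrite /= in_itv/= ler01 lexx.
    by rewrite scale1r subrKC.
  move=> [y py [t]]; rewrite /= in_itv/= => /andP[t0 t1] <-.
  rewrite opprD addNKr normrN normrZ ger0_norm// distrC.
  by apply: le_lt_trans py; rewrite ler_piMl.
apply: bigcup_connected.
  exists p => x _; exists 0; first by rewrite /= in_itv/= ler01 lexx.
  by rewrite scale0r addr0.
move=> x _; apply: connected_continuous_connected; first exact: segment_connected.
apply: continuous_subspaceT => t.
apply: cvgD; first exact: cvg_cst.
apply: cvgZr_tmp; exact: cvg_id.
Qed.

Lemma ball_chart_dom L (p : quat R) (e : R) :
  separated_by L (e + e) -> chart_dom L (ball p e).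
Proof.
move=> sL; split; [exact: ball_open|exact: connected_quat_ball|].
move=> x y; rewrite !inE -!ball_normE/= => px py /torus_piP Lxy.
apply/eqP; rewrite -subr_eq0; apply/eqP; apply: sL => //.
rewrite -(subrKA p); apply: le_lt_trans (ler_normD _ _) _.
by rewrite ltrD// distrC.
Qed.

Lemma torus_pi_chart L U (t : torus L) : chart_dom L U ->
  (torus_pi L @` U) t -> U (chart U t) /\ torus_pi L (chart U t) = t.
Proof.
move=> [_ _ iU] Ut; split; last by apply: pinvK; rewrite inE.
case: Ut => x Ux <-; rewrite /chart pinvKV//; exact: mem_set.
Qed.

Lemma chart_torus_pi L U (x : quat R) : chart_dom L U -> U x ->
  chart U (torus_pi L x) = x.
Proof. by move=> [_ _ iU] Ux; rewrite /chart pinvKV//; exact: mem_set. Qed.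

End TorusProjection.

(** * Slices *)

Section SliceCoordinates.
Variable R : realType.
Implicit Types (I : quat R) (x y : R).

Definition slice_point I x y : quat R := x%:A + y *: I.

Lemma slice_point_continuous I : continuous (fun z : R * R => slice_point I z.1 z.2).
Proof.
move=> z; apply: cvgD; apply: cvgZr_tmp; [exact: cvg_fst|exact: cvg_snd].
Qed.

Lemma slice_point_ball I x0 y0 (r : R) : 0 < r ->
  exists2 s : R, 0 < s & forall x y, `|x - x0| < s -> `|y - y0| < s ->
    ball (slice_point I x0 y0) r (slice_point I x y).
Proof.
move=> r0.
have [s /= s0 hs] : exists2 s : R, 0 < s &
    ball (x0, y0) s `<=` [set z | ball (slice_point I x0 y0) r (slice_point I z.1 z.2)].
  apply/nbhs_ballP; have := @slice_point_continuous I (x0, y0).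
  by apply; apply/nbhs_ballP; exists r.
exists s => // x y xs ys.
by apply: (hs (x, y)); split; rewrite -ball_normE/= distrC.
Qed.

Lemma imag_units_i : imag_units (mkquat 0 1 0 0 : quat R).
Proof. by apply/imag_unitsP; rewrite !qE; split=> //; ring. Qed.

Lemma slice_pointP (q : quat R) : exists I x y, imag_units I /\ q = slice_point I x y.
Proof.
pose n := q1 q ^+ 2 + q2 q ^+ 2 + q3 q ^+ 2.
have n0 : 0 <= n by rewrite !addr_ge0 ?sqr_ge0.
have [n0'|n1] := eqVneq n 0.
  exists (mkquat 0 1 0 0), (q0 q), 0; split; first exact: imag_units_i.
  rewrite /slice_point scale0r addr0; apply: quat_ext; rewrite !qcoord ?mulr1 ?mulr0//;
  apply/eqP; rewrite -sqrf_eq0; apply/eqP; rewrite /n in n0';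
  have := sqr_ge0 (q1 q); have := sqr_ge0 (q2 q); have := sqr_ge0 (q3 q); lra.
have s0 : Num.sqrt n != 0 by rewrite gt_eqF// sqrtr_gt0 lt_def n1.
exists ((Num.sqrt n)^-1 *: mkquat 0 (q1 q) (q2 q) (q3 q)), (q0 q), (Num.sqrt n); split.
  apply/imag_unitsP; rewrite !qcoord mulr0; split=> //.
  by rewrite !exprMn -!mulrDr exprVn sqr_sqrtr// mulVf.
by apply: quat_ext; rewrite !qcoord mulVKf//; ring.
Qed.

(** A pointwise form of regularity: the continuity of the partial derivatives on
    the trace of [Om] is continuity at each of its points because this trace is
    open. *)
Lemma slice_regular_at (Om : set (quat R)) (f : quat R -> quat R) I x y :
  slice_regular Om f -> imag_units I -> Om (slice_point I x y) ->
  [/\ is_derive x 1 (fun t : R => slice_restr f I t y) (slice_dx f I x y),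
      is_derive y 1 (fun t : R => slice_restr f I x t) (slice_dy f I x y),
      slice_dx f I x y + I * slice_dy f I x y = 0 &
      {for (x, y), continuous (fun z : R * R => slice_dx f I z.1 z.2)}].
Proof.
move=> [oOm /(_ I) h] II Omxy; have [h1 h2 h3 h4] := h II.
have [hx hy] := h1 _ _ Omxy.
split.
- by have := derivableP hx; rewrite -derive1E.
- by have := derivableP hy; rewrite -derive1E.
- have h5 := h4 x y Omxy.
  have k0 : (2^-1 : R) != 0 by rewrite invr_eq0 pnatr_eq0.
  by apply: (scalerI k0); rewrite scaler0.
have oS : open (slice_dom Om I).
  have -> : slice_dom Om I = (fun z : R * R => slice_point I z.1 z.2) @^-1` Om by [].
  apply: open_comp => [z _|//]; exact: slice_point_continuous.
have := h2.
rewrite (continuous_open_subspace _ oS).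
by move=> /(_ (x, y)); apply; rewrite inE.
Qed.

End SliceCoordinates.
(** * Curves with constant velocity *)

Lemma is_derive_eq_dist (R : realType) (V : normedModType R) (f g : R -> V)
    (t r : R) dg : 0 < r -> (forall s, `|s - t| < r -> f s = g s) ->
  is_derive t 1 g dg -> is_derive t 1 f dg.
Proof.
move=> r0 fg /is_derive1P h; apply/is_derive1P.
apply: cvg_trans h; apply: near_eq_cvg.
have : \forall k \near (0 : R)^', `|k| < r by exact: dnbhs0_lt.
apply: filterS => k kr /=; rewrite !fg ?subrr ?normr0//.
by rewrite addrK.
Qed.

Lemma is_derive_translate (R : realType) (V : normedModType R) (f : R -> V) (t c : R) df :
  is_derive (t + c) 1 f df -> is_derive t 1 (fun s => f (s + c)) df.
Proof.
move=> /is_derive1P h; apply/is_derive1P.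
by under eq_fun do rewrite -addrA.
Qed.

Lemma is_derive_cst_affine1 (R : realType) (f : R -> R) (t r c : R) :
  (forall s : R, `|s - t| < r -> is_derive s 1 f c) ->
  forall s, `|s - t| < r -> f s = f t + (s - t) * c.
Proof.
move=> df s sr.
have fE (a b : R) : a <= b -> `|a - t| < r -> `|b - t| < r -> f b - f a = c * (b - a).
  move=> ab ar br.
  have dab u : u \in `[a, b] -> is_derive u 1 f c.
    rewrite in_itv/= => /andP[au ub]; apply: df; move: ar br.
    rewrite !ltr_norml => /andP[a1 a2] /andP[b1 b2].
    by apply/andP; split; [apply: lt_le_trans a1 _|apply: le_lt_trans b2]; rewrite lerD2r.
  have cab : {within `[a, b], continuous f}.
    by apply: derivable_within_continuous => u /dab[].
  have dab' u : u \in `]a, b[ -> is_derive u 1 f c.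
    by move=> /subset_itv_oo_cc; exact: dab.
  by have [z _] := MVT_segment ab dab' cab.
have tr : `|t - t| < r by rewrite subrr normr0; exact: le_lt_trans (normr_ge0 _) sr.
apply/eqP; rewrite -subr_eq0 opprD addrA subr_eq0; apply/eqP.
have [st|/ltW ts] := leP s t; last by rewrite fE// mulrC.
by rewrite -opprB fE// -mulrN opprB mulrC.
Qed.

Lemma is_derive_cst_affine (R : realType) (g : R -> quat R) (t r : R) (c : quat R) :
  (forall s : R, `|s - t| < r -> is_derive s 1 g c) ->
  forall s, `|s - t| < r -> g s = g t + (s - t) *: c.
Proof.
move=> dg s sr; apply/rowP => i; rewrite !mxE.
apply: (@is_derive_cst_affine1 R (fun s => g s ord0 i) t r _ _ s sr) => u ur.
exact: is_derive_linear_quat (@linear_coord R i) (dg u ur).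
Qed.

(** The connectedness of the line, used to continue an identity from one point to
    all: the indicator function of [A] has derivative zero everywhere. *)
Lemma locally_constant_prop (R : realType) (A : R -> Prop) :
  (forall t, exists2 r, 0 < r & forall s, `|s - t| < r -> (A s <-> A t)) ->
  A 0 -> forall t, A t.
Proof.
move=> lA A0 t.
pose g s : R := if `[< A s >] then 0 else 1.
have dg (s : R) : is_derive s 1 g 0.
  have [r r0 h] := lA s.
  apply: (@is_derive_eq_dist _ _ _ (cst (g s)) _ r) => // u us.
  by rewrite /g /=; congr (if _ then _ else _); apply/asbool_equiv_eq/h.
have := is_derive_0_is_cst t 0 dg; rewrite /g (asboolT A0).
by case: asboolP => // _ /eqP; rewrite oner_eq0.
Qed.

(** * Local lifts of regular maps *)

Section RegularMapsLift.
Variables (R : realType) (L M : lattice R) (F : torus L -> torus M).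
Hypothesis regF : torus_regular F.
Variable e : R.
Hypotheses (e0 : 0 < e) (sepL : separated_by L (e + e)) (sepM : separated_by M (e + e)).

Lemma regular_lift q0 : exists y r f, [/\ 0 < r, slice_regular (ball q0 r) f &
  forall q, ball q0 r q -> ball y e (f q) /\ torus_pi M (f q) = F (torus_pi L q)].
Proof.
have [y yE] := torus_pi_surj (F (torus_pi L q0)).
have cU := ball_chart_dom q0 sepL; have cV := ball_chart_dom y sepM.
have := regF cU cV; set Om := _ `&` _; set f := _ \o _ => regf.
have Om0 : Om q0.
  split; first exact: ballxx.
  by exists y => //; exact: ballxx.
have oOm : open Om by case: regf.
have [r /= r0 rOm] : exists2 r : R, 0 < r & ball q0 r `<=` Om.
  by apply/nbhs_ballP; exact: open_nbhs_nbhs.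
exists y, r, f; split=> //.
  split; first exact: ball_open.
  move=> I II; have [h1 h2 h3 h4] := regf.2 I II.
  have sub : slice_dom (ball q0 r) I `<=` slice_dom Om I by move=> z; exact: rOm.
  split.
  - by move=> x z hz; apply: h1; exact: sub.
  - exact: continuous_subspaceW h2.
  - exact: continuous_subspaceW h3.
  - by move=> x z hz; apply: h4; exact: sub.
move=> q /rOm [_ Fq].
by have [h1 h2] := torus_pi_chart cV Fq.
Qed.

Lemma regular_slice_lift I x0 y0 : imag_units I ->
  exists w r f fx fy, 0 < r /\ forall x y, `|x - x0| < r -> `|y - y0| < r ->
  [/\ `|w - f x y| < e /\ torus_pi M (f x y) = F (torus_pi L (slice_point I x y)),
      is_derive x 1 (f^~ y) (fx x y), is_derive y 1 (f x) (fy x y),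
      fx x y + I * fy x y = 0 &
      {for (x, y), continuous (fun z : R * R => fx z.1 z.2)}].
Proof.
move=> II; have [w [r [f [r0 regf hf]]]] := regular_lift (slice_point I x0 y0).
have [s s0 hs] := slice_point_ball I x0 y0 r0.
exists w, s, (slice_restr f I), (slice_dx f I), (slice_dy f I); split=> // x y xs ys.
have xyr := hs x y xs ys.
have [h1 h2 h3 h4] := slice_regular_at regf II xyr.
by split=> //; have := hf _ xyr; rewrite -ball_normE.
Qed.

(** A Lebesgue number: since [F] composed with the projection is periodic, the
    compact closed ball that meets every class of [L] suffices. *)
Lemma uniform_lift : exists2 d : R, 0 < d & forall q, exists y,
  forall q', `|q - q'| < d ->
    exists z, `|y - z| < e /\ torus_pi M z = F (torus_pi L q').
Proof.
pose P d q := exists y, forall q', `|q - q'| < d ->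
    exists z, `|y - z| < e /\ torus_pi M z = F (torus_pi L q').
have [r hr] := lattice_cobounded L.
pose K := [set q : quat R | `|q| <= r].
have cK : compact K.
  apply: (@bounded_closed_compact R 4 K).
    exists r; split; first exact: num_real.
    by move=> s rs q /= qr; apply: le_trans qr (ltW rs).
  apply: (@closed_comp _ _ (fun q : quat R => `|q|) [set s | s <= r]).
    by move=> q _; exact: norm_continuous.
  exact: closed_le.
have near_P : \forall d \near 0^'+, K `<=` P d.
  apply: (iffLR (compact_near_coveringP K) cK).
  move=> x _; have [y [s [f [s0 _ hf]]]] := regular_lift x.
  exists (ball x (s / 2), [set d | d < s / 2]).
    split=> /=; first by apply: nbhsx_ballx; rewrite divr_gt0.
    by apply: nbhs_right_lt; rewrite divr_gt0.
  move=> [x' d] [/= xx' ds]; exists y => q' q'd; exists (f q').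
  have /hf : ball x s q'.
    move: xx'; rewrite -!ball_normE/= => xx'.
    rewrite -(subrKA x'); apply: le_lt_trans (ler_normD _ _) _.
    by rewrite [ltRHS](splitr s) ltrD// (lt_trans q'd).
  by rewrite -ball_normE.
have [d [dP d0]] : exists d, K `<=` P d /\ 0 < d.
  have := filter_ex (filterI near_P (nbhs_right_gt (0 : R))).
  by case=> d [h1 h2]; exists d.
exists d => // q; have [l Ll ql] := hr q.
have [y hy] := dP (q - l) ql.
exists y => q' q'd; have [|z [z1 z2]] := hy (q' - l).
  by rewrite opprB addrA subrK.
exists z; split=> //; rewrite z2; congr F.
by apply: torus_piDl; exact: latticeN.
Qed.

End RegularMapsLift.

(** * Rigidity of regular maps *)

Section RegularAffine.
Variables (R : realType) (L M : lattice R) (F : torus L -> torus M).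
Hypothesis regF : torus_regular F.
Variable e : R.
Hypotheses (e0 : 0 < e) (sepL : separated_by L (e + e)).
(* Two increments and two differences of lifts, each shorter than [e + e], are
   compared in [increment_slice]: hence the factor eight. *)
Hypothesis sepM8 : separated_by M (e + e + (e + e) + (e + e + (e + e))).

Let sepM : separated_by M (e + e).
Proof. by move=> l Ml le; apply: sepM8 => //; apply: lt_trans le _; rewrite -addrA ltrDl !addr_gt0. Qed.

(** [D h q] is the short vector by which every lift of the image of [q] has to be
    moved to lift the image of [q + h].  It is defined on the whole space although
    the lifts are only local. *)
Let exists_increment : exists d (D : R -> quat R -> quat R), 0 < d /\
  forall h, `|h| < d -> forall q, `|D h q| < e + e /\
    forall w, torus_pi M w = F (torus_pi L q) ->
      torus_pi M (w + D h q) = F (torus_pi L (q + h%:A)).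
Proof.
have [d d0 hd] := uniform_lift regF e0 sepL sepM.
have n1 : 0 < `|1 : quat R| by rewrite normr_gt0 oner_neq0.
exists (d / `|1 : quat R|).
have /choice[D hD] : forall z : R * quat R, exists D : quat R,
    `|z.1| < d / `|1 : quat R| -> `|D| < e + e /\
    forall w, torus_pi M w = F (torus_pi L z.2) ->
      torus_pi M (w + D) = F (torus_pi L (z.2 + z.1%:A)).
  move=> [h q] /=; have [hd'|hd'] := boolP (`|h| < d / `|1 : quat R|); last by exists 0.
  have [y hy] := hd q.
  have [|z1 [z1y z1E]] := hy q; first by rewrite subrr normr0.
  have [|z2 [z2y z2E]] := hy (q + h%:A).
    by rewrite opprD addNKr normrN normrZ -ltr_pdivlMr.
  exists (z2 - z1) => _; split.
    rewrite -(subrKA y); apply: le_lt_trans (ler_normD _ _) _.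
    by rewrite ltrD// distrC.
  move=> w wE; rewrite -z2E addrC -addrA -[RHS]/(torus_pi M z2).
  apply/torus_piP; rewrite -addrA addrC subrK addrC.
  by apply/torus_piP; rewrite wE z1E.
exists (fun h q => D (h, q)); split; first by rewrite divr_gt0.
by move=> h hd' q; exact: (hD (h, q)).
Qed.

Section Increment.
Variables (d : R) (D : R -> quat R -> quat R).
Hypotheses (d0 : 0 < d) (hD : forall h, `|h| < d -> forall q, `|D h q| < e + e /\
    forall w, torus_pi M w = F (torus_pi L q) ->
      torus_pi M (w + D h q) = F (torus_pi L (q + h%:A))).

Let slice_pointD I x y h : slice_point I x y + h%:A = slice_point I (x + h) y :> quat R.
Proof. by rewrite /slice_point scalerDl addrAC. Qed.

Let dist_lt (w z z' : quat R) : `|w - z| < e -> `|w - z'| < e -> `|z' - z| < e + e.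
Proof.
move=> h h'; rewrite -(subrKA w); apply: le_lt_trans (ler_normD _ _) _.
by rewrite ltrD// distrC.
Qed.

(** Near a point, [D h] and the difference of two local lifts differ by an element
    of [M].  Both vary by little, so this element is constant, and [D h] inherits
    the regularity of the lifts. *)
Let increment_slice I (h x0 y0 : R) : imag_units I -> `|h| < d ->
  exists r (fx fy : R -> R -> quat R), 0 < r /\
  forall x y, `|x - x0| < r -> `|y - y0| < r ->
  [/\ is_derive x 1 (fun s => D h (slice_point I s y)) (fx x y),
      is_derive y 1 (fun s => D h (slice_point I x s)) (fy x y),
      fx x y + I * fy x y = 0 &
      {for (x, y), continuous (fun z : R * R => fx z.1 z.2)}].
Proof.
move=> II hd.
have [w1 [r1 [f1 [fx1 [fy1 [r10 h1]]]]]] := regular_slice_lift regF e0 sepL sepM x0 y0 II.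
have [w2 [r2 [f2 [fx2 [fy2 [r20 h2]]]]]] :=
  regular_slice_lift regF e0 sepL sepM (x0 + h) y0 II.
pose r := Num.min r1 r2.
have r0 : 0 < r by rewrite lt_min r10.
have rr1 s : s < r -> s < r1 by rewrite lt_min => /andP[].
have rr2 s : s < r -> s < r2 by rewrite lt_min => /andP[].
have sh x : `|x - x0| < r -> `|x + h - (x0 + h)| < r2.
  by move=> /rr2; rewrite opprD addrACA subrr addr0.
pose D' x y := D h (slice_point I x y).
pose G x y := f2 (x + h) y - f1 x y.
have DG x y : `|x - x0| < r -> `|y - y0| < r -> lattice_set M (D' x y - G x y).
  move=> xr yr.
  have [[_ a1] _ _ _ _] := h1 _ _ (rr1 _ xr) (rr1 _ yr).
  have [[_ a2] _ _ _ _] := h2 _ _ (sh _ xr) (rr2 _ yr).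
  have [_ /(_ _ a1)] := hD hd (slice_point I x y).
  rewrite slice_pointD -a2 => /torus_piP.
  by rewrite /G opprB addrA [D' x y + _]addrC.
have r00 : `|x0 - x0| < r by rewrite subrr normr0.
have r01 : `|y0 - y0| < r by rewrite subrr normr0.
pose k := D' x0 y0 - G x0 y0.
have DE x y : `|x - x0| < r -> `|y - y0| < r -> D' x y = G x y + k.
  move=> xr yr; apply/eqP; rewrite -subr_eq0 opprD addrA; apply/eqP.
  apply: sepM8; first by apply: latticeB; exact: DG.
  rewrite /k /G.
  have [[a1 _] _ _ _ _] := h1 _ _ (rr1 _ xr) (rr1 _ yr).
  have [[a2 _] _ _ _ _] := h2 _ _ (sh _ xr) (rr2 _ yr).
  have [[b1 _] _ _ _ _] := h1 _ _ (rr1 _ r00) (rr1 _ r01).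
  have [[b2 _] _ _ _ _] := h2 _ _ (sh _ r00) (rr2 _ r01).
  have c1 := dist_lt b1 a1; have c2 := dist_lt a2 b2.
  have [d1 _] := hD hd (slice_point I x y).
  have [d2 _] := hD hd (slice_point I x0 y0).
  rewrite -/(D' x y) in d1; rewrite -/(D' x0 y0) in d2.
  set A := f2 (x + h) y in c2 *; set B := f1 x y in c1 *.
  set A0 := f2 (x0 + h) y0 in c2 *; set B0 := f1 x0 y0 in c1 *.
  have -> : D' x y - (A - B) - (D' x0 y0 - (A0 - B0)) =
      (D' x y - D' x0 y0) + ((A0 - A) + (B - B0)).
    by apply: quat_ext; rewrite !qcoord; ring.
  apply: le_lt_trans (ler_normD _ _) _; apply: ltrD.
    by apply: le_lt_trans (ler_normB _ _) _; apply: ltrD.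
  by apply: le_lt_trans (ler_normD _ _) _; apply: ltrD.
exists r, (fun x y => fx2 (x + h) y - fx1 x y), (fun x y => fy2 (x + h) y - fy1 x y).
split=> // x y xr yr.
have [_ a1 b1 c1 k1] := h1 _ _ (rr1 _ xr) (rr1 _ yr).
have [_ a2 b2 c2 k2] := h2 _ _ (sh _ xr) (rr2 _ yr).
have margin (s s0 : R) : `|s - s0| < r -> exists2 r', 0 < r' & forall u, `|u - s| < r' -> `|u - s0| < r.
  move=> sr; exists (r - `|s - s0|); first by rewrite subr_gt0.
  move=> u us; rewrite -(subrKA s); apply: le_lt_trans (ler_normD _ _) _.
  by rewrite -ltrBrDr.
have [rx rx0 hx] := margin _ _ xr; have [ry ry0 hy] := margin _ _ yr.
split.
- refine (@is_derive_eq_dist R (quat R) _ (fun s => G s y + k) x rx _ rx0 _ _).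
    by move=> s sx; apply: DE => //; exact: hx.
  have a2' := is_derive_translate a2.
  by apply: is_derive_eq; rewrite addr0.
- refine (@is_derive_eq_dist R (quat R) _ (fun s => G x s + k) y ry _ ry0 _ _).
    by move=> s sx; apply: DE => //; exact: hy.
  by apply: is_derive_eq; rewrite addr0.
- rewrite mulrBr addrACA -opprD.
  by rewrite c1 c2 subr0.
- apply: cvgB; last exact: k1.
  have p1 : (z.1 + h) @[z --> (x, y)] --> x + h.
    by apply: cvgD; [exact: cvg_fst|exact: cvg_cst].
  have p2 : z.2 @[z --> (x, y)] --> y by exact: cvg_snd.
  have p3 : (z.1 + h, z.2) @[z --> (x, y)] --> (x + h, y) by exact: cvg_pair p1 p2.
  exact: cvg_comp p3 k2.
Qed.

Let slice_point00 (I : quat R) : slice_point I 0 0 = 0.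
Proof. by rewrite /slice_point !scale0r addr0. Qed.

(** Liouville's theorem on each slice; all slices contain the origin. *)
Let increment_cst h q : `|h| < d -> D h q = D h 0.
Proof.
move=> hd; have [I [x [y [II ->]]]] := slice_pointP q.
pose D' x y := D h (slice_point I x y).
have loc (s t : R) : exists fx fy : quat R,
    [/\ is_derive s 1 (fun u : R => D' u t) fx, is_derive t 1 (D' s) fy &
        fx + I * fy = 0].
  have [r [fx [fy [r0 hr]]]] := increment_slice s t II hd.
  have [||h1 h2 h3 _] := hr s t; rewrite ?subrr ?normr0//.
  by exists (fx s t), (fy s t).
have dDx (s t : R) : is_derive s 1 (fun u : R => D' u t) ('D_1 (fun u : R => D' u t) s).
  by have [fx [fy [[h1 _] _ _]]] := loc s t; exact/derivableP.
have dDy (s t : R) : is_derive t 1 (D' s) ('D_1 (D' s) t).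
  by have [fx [fy [_ [h1 _] _]]] := loc s t; exact/derivableP.
have CR s t : 'D_1 (fun u : R => D' u t) s + I * 'D_1 (D' s) t = 0.
  by have [fx [fy [[_ ->] [_ ->]]]] := loc s t.
pose Dx2 (z : R * R) := 'D_1 (fun u : R => D' u z.2) z.1.
have cDx : continuous Dx2.
  move=> [s t].
  have [r [fx [fy [r0 hr]]]] := increment_slice s t II hd.
  have [||_ _ _ cfx] := hr s t; rewrite ?subrr ?normr0//.
  have E : \forall z \near (s, t), Dx2 z = fx z.1 z.2.
    exists (ball s r, ball t r) => /=.
      by split; exact: nbhsx_ballx.
    move=> [u v] [/= us vt]; move: us vt; rewrite -!ball_normE/= => us vt.
    by have [||[_ h1] _ _ _] := hr u v; [rewrite distrC|rewrite distrC|exact: h1].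
  rewrite /continuous_at (_ : Dx2 (s, t) = fx s t); last first.
    by have [||[_ h1] _ _ _] := hr s t; [rewrite subrr normr0|rewrite subrr normr0|exact: h1].
  apply: cvg_trans cfx; apply: near_eq_cvg.
  by apply: filterS E => z ->.
have DB s t : `|D' s t| <= e + e.
  by have [/ltW] := hD hd (slice_point I s t).
have Dx0 := bounded_slice_derive0 II dDx dDy CR cDx DB.
have Dy0 s t : 'D_1 (D' s) t = 0.
  have := CR s t; rewrite Dx0 add0r => /(congr1 (fun q => I * q)).
  by rewrite (imag_unitsM _ II) mulr0 => /eqP; rewrite oppr_eq0 => /eqP.
rewrite -/(D' x y) -(slice_point00 I) -/(D' 0 0).
have cy (t : R) : is_derive t 1 (D' x) 0.
  by apply: is_derive_eq (dDy x t) _; rewrite Dy0.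
have cx (t : R) : is_derive t 1 (fun u => D' u 0) 0.
  by apply: is_derive_eq (dDx t 0) _; rewrite Dx0.
by rewrite (is_derive0_quat_cst cy y 0) (is_derive0_quat_cst cx x 0).
Qed.

Let increment_unique (h : R) w w' q : `|h| < d ->
  torus_pi M w = F (torus_pi L q) -> torus_pi M w' = F (torus_pi L (q + h%:A)) ->
  `|w' - w| < e + e -> w' = w + D h 0.
Proof.
move=> hd wE wE' ww'; have [a b] := hD hd q.
have := b _ wE; rewrite -wE' => /torus_piP.
rewrite -(increment_cst q hd) => Mw.
apply/esym/eqP; rewrite -subr_eq0; apply/eqP; apply: sepM8 => //.
rewrite addrAC addrC; apply: le_lt_trans (ler_normD _ _) _.
rewrite distrC in ww'.
have ee : 0 < e + e + (e + e) by rewrite !addr_gt0.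
by apply: lt_trans (ltrD a ww') _; rewrite ltrDl.
Qed.

(** A local lift moves by [D h 0] when its argument moves by [h], at every point;
    hence its slice derivative is the derivative of [D] in [h] at 0, the same for
    all lifts and all slices. *)
Let lift_velocity I x0 y0 : imag_units I ->
  exists r f a fy, 0 < r /\ (is_derive (0 : R) 1 (D^~ 0) a /\
  forall x y, `|x - x0| < r -> `|y - y0| < r ->
  [/\ torus_pi M (f x y) = F (torus_pi L (slice_point I x y)),
      is_derive x 1 (f^~ y) a, is_derive y 1 (f x) (fy x y) & a + I * fy x y = 0]).
Proof.
move=> II.
have [w [r [f [fx [fy [r0 hr]]]]]] := regular_slice_lift regF e0 sepL sepM x0 y0 II.
have key x y : `|x - x0| < r -> `|y - y0| < r -> is_derive (0 : R) 1 (D^~ 0) (fx x y).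
  move=> xr yr; have [[h1 h2] h3 h4 h5 h6] := hr x y xr yr.
  have s0 : 0 < Num.min d (r - `|x - x0|) by rewrite lt_min d0 subr_gt0.
  refine (@is_derive_eq_dist R (quat R) _ (fun h => f (h + x) y - f x y) 0 _ _ s0 _ _).
    move=> h; rewrite subr0 lt_min => /andP[hd hx].
    have hxr : `|h + x - x0| < r.
      rewrite -addrA; apply: le_lt_trans (ler_normD _ _) _.
      by rewrite -ltrBrDr.
    have [[k1 k2] _ _ _ _] := hr (h + x) y hxr yr.
    rewrite (@increment_unique h (f x y) (f (h + x) y) (slice_point I x y))//.
    - by rewrite addrAC subrr add0r.
    - by rewrite slice_pointD [x + h]addrC.
    - exact: dist_lt h1 k1.
  have h3' : is_derive (0 + x) 1 (f^~ y) (fx x y) by rewrite add0r.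
  have := is_derive_translate h3' => h7.
  by apply: is_derive_eq; rewrite subr0.
have k0 : is_derive (0 : R) 1 (D^~ 0) (fx x0 y0) by apply: key; rewrite subrr normr0.
exists r, f, (fx x0 y0), fy; split=> //; split=> // x y xr yr.
have [[? ?] k1 k2 k3 _] := hr x y xr yr.
suff <- : fx x y = fx x0 y0 by split.
by case: (key x y xr yr) => _ <-; case: k0 => _ <-.
Qed.

Let local_affine I x0 y0 a : imag_units I -> is_derive (0 : R) 1 (D^~ 0) a ->
  exists2 r, 0 < r & forall x y, `|x - x0| < r -> `|y - y0| < r ->
    exists w, torus_pi M w = F (torus_pi L (slice_point I x0 y0)) /\
      torus_pi M (w + (slice_point I x y - slice_point I x0 y0) * a) =
      F (torus_pi L (slice_point I x y)).
Proof.
move=> II Da; have [r [f [a' [fy [r0 [Da' hr]]]]]] := lift_velocity x0 y0 II.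
have {Da Da'} aa' : a' = a by case: Da => _ <-; case: Da' => _ <-.
subst a'; exists r => // x y xr yr; exists (f x0 y0).
have x0r : `|x0 - x0| < r by rewrite subrr normr0.
have y0r : `|y0 - y0| < r by rewrite subrr normr0.
split; first by have [] := hr x0 y0 x0r y0r.
have fyE t : `|t - y0| < r -> fy x0 t = I * a.
  move=> /(hr x0 t x0r)[_ _ _ /(congr1 (fun q => I * q))].
  by rewrite mulrDr mulr0 (imag_unitsM _ II) => /eqP; rewrite subr_eq0 => /eqP.
have [<- _ _ _] := hr x y xr yr; congr torus_pi.
have E1 := @is_derive_cst_affine R (f^~ y) x0 r a (fun s sr => let: And4 _ p _ _ := hr s y sr yr in p) x xr.
have E2 : f x0 y = f x0 y0 + (y - y0) *: (I * a).
  apply: (@is_derive_cst_affine R (f x0) y0 r) => // s sr.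
  by rewrite -(fyE s sr); have [] := hr x0 s x0r sr.
rewrite E1 E2 -[RHS]addrA; congr (_ + _).
have -> : slice_point I x y - slice_point I x0 y0 = (x - x0)%:A + (y - y0) *: I.
  by rewrite /slice_point opprD addrACA -!scalerBl.
by rewrite mulrDl -!scalerAl mul1r addrC.
Qed.

(** The common slice derivative [a] determines the local lifts up to constants, and
    the constants are compared along a real segment followed by an imaginary one,
    which reaches every point of a slice from the origin. *)
Lemma increment_regular_affine :
  exists a c : quat R, forall q, F (torus_pi L q) = torus_pi M (c + q * a).
Proof.
have [c cE] := torus_pi_surj (F (torus_pi L 0)).
have [r [f [a [fy [r0 [Da _]]]]]] := lift_velocity 0 0 (@imag_units_i R).
exists a, c => q; have [I [x [y [II ->]]]] := slice_pointP q.
pose A x y := F (torus_pi L (slice_point I x y)) = torus_pi M (c + slice_point I x y * a).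
have locA x0 y0 : exists2 r, 0 < r & forall x y, `|x - x0| < r -> `|y - y0| < r ->
    (A x y <-> A x0 y0).
  have [s s0 hs] := local_affine x0 y0 II Da; exists s => // u v us vs.
  have [w [w1 w2]] := hs u v us vs; rewrite /A -w1 -w2.
  set P := slice_point I u v; set P0 := slice_point I x0 y0.
  have E : c + P * a = c + P0 * a + (P - P0) * a by rewrite -addrA -mulrDl subrKC.
  split=> [|h]; last by rewrite E; exact: torus_piD.
  rewrite E => /(torus_piD (- ((P - P0) * a))).
  by rewrite !addrK.
have A00 : A 0 0 by rewrite /A slice_point00 mul0r addr0.
have Ax0 : A x 0.
  apply: (@locally_constant_prop R (A^~ 0)) => // t.
  have [s s0 hs] := locA t 0; exists s => // u us; apply: hs => //.
  by rewrite subrr normr0.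
apply: (@locally_constant_prop R (A x)) => // t.
have [s s0 hs] := locA x t; exists s => // u us; apply: hs => //.
by rewrite subrr normr0.
Qed.

End Increment.

Lemma regular_affine_at_scale :
  exists a c : quat R, forall q, F (torus_pi L q) = torus_pi M (c + q * a).
Proof.
have [d [D [d0 hD]]] := exists_increment.
exact: increment_regular_affine d0 hD.
Qed.

End RegularAffine.

Theorem torus_regular_affine (R : realType) (L M : lattice R) (F : torus L -> torus M) :
  torus_regular F ->
  exists a c : quat R, forall q, F (torus_pi L q) = torus_pi M (c + q * a).
Proof.
move=> regF.
have [eL eL0 hL] := lattice_separated L.
have [eM eM0 hM] := lattice_separated M.
have [e e0 [h1 h2]] : exists2 e : R, 0 < e & e + e <= eL /\
    e + e + (e + e) + (e + e + (e + e)) <= eM.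
  exists (Num.min (eL / 8%:R) (eM / 8%:R)).
    by rewrite lt_min !divr_gt0.
  set e := Num.min _ _.
  have e1 : e <= eL / 8%:R by rewrite ge_min lexx.
  have e2 : e <= eM / 8%:R by rewrite ge_min lexx orbT.
  split; lra.
apply: (regular_affine_at_scale regF e0).
- by move=> l Ll le; apply: hL => //; exact: lt_le_trans le h1.
- by move=> l Ml le; apply: hM => //; exact: lt_le_trans le h2.
Qed.

(** * The plane of an imaginary unit *)

Section SlicePlane.
Variable R : realType.
Implicit Types (I : quat R) (x y : R).

Lemma slice_pointM I x y x' y' : imag_units I ->
  slice_point I x y * slice_point I x' y' =
  slice_point I (x * x' - y * y') (x * y' + y * x').
Proof.
move=> II.
transitivity ((x * x')%:A + (x * y' + y * x') *: I + (y * y') *: (I ^+ 2)).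
  by rewrite /slice_point expr2; apply: quat_ext; rewrite !qcoord; ring.
by rewrite II /slice_point; apply: quat_ext; rewrite !qcoord; ring.
Qed.

Lemma q0_slice_point I x y : imag_units I -> q0 (slice_point I x y) = x.
Proof. by move=> /imag_unitsP[I0 _]; rewrite /slice_point !qcoord I0; ring. Qed.

Lemma qdot_slice_point I x y : imag_units I -> qdot (slice_point I x y) I = y.
Proof.
move=> /imag_unitsP[I0 I1]; rewrite /slice_point qdotE !qcoord I0 -[RHS]mulr1 -[X in _ = _ * X]I1; ring.
Qed.

Lemma qnorm2_slice_point I x y : imag_units I ->
  qnorm2 (slice_point I x y) = x ^+ 2 + y ^+ 2.
Proof.
move=> /imag_unitsP[I0 I1]; rewrite /slice_point qnorm2E !qcoord I0.
by rewrite -[y ^+ 2 in RHS]mulr1 -[X in _ = _ + _ * X]I1; ring.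
Qed.

Definition in_plane I : set (quat R) := [set q | exists x y, q = slice_point I x y].

Lemma exists_notin_plane I : imag_units I -> exists q, ~ in_plane I q.
Proof.
move=> II; apply: contrapT => h.
have all q : in_plane I q by apply: contrapT => hq; apply: h; exists q.
have [x1 [y1 e1]] := all (mkquat 0 1 0 0); have [x2 [y2 e2]] := all (mkquat 0 0 1 0).
have a1 := congr1 q1 e1; have a2 := congr1 q2 e1.
have b1 := congr1 q1 e2; have b2 := congr1 q2 e2.
move: a1 a2 b1 b2; rewrite /slice_point !qcoord !mulr0 !add0r => a1 a2 b1 b2.
have : (y1 * q1 I) * (y2 * q2 I) = (y1 * q2 I) * (y2 * q1 I) by ring.
by rewrite -a1 -b2 -a2 -b1 mulr1 mulr0 => /eqP; rewrite oner_eq0.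
Qed.

(** The plane of [I] is a field: a relation with a nonzero coefficient on [al] could
    be divided by it, which would put [al] in the plane. *)
Lemma free_slice_basis I al : imag_units I -> ~ in_plane I al ->
  free [tuple 1; I; al; al * I].
Proof.
move=> II nal; apply/freeP => k.
rewrite !big_ord_recl big_ord0 /= addr0.
set x := k _; set y := k _; set a := k _; set b := k _ => h.
have {}h : slice_point I x y + al * slice_point I a b = 0.
  by rewrite -[RHS]h /slice_point mulrDr -!scalerAr mulr1 !addrA.
have ab0 : a ^+ 2 + b ^+ 2 = 0.
  apply/eqP; apply: contra_notT nal => ab.
  (* The inverse of [a + b I] is [(a - b I) / n]. *)
  pose n := a ^+ 2 + b ^+ 2.
  exists (- (x * (a / n) + y * (b / n))), (- (y * (a / n) - x * (b / n))).
  have E : slice_point I a b * slice_point I (a / n) (- (b / n)) = 1.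
    rewrite slice_pointM//.
    have -> : a * (a / n) - b * (- (b / n)) = 1 by rewrite -(mulfV ab) /n; ring.
    have -> : a * (- (b / n)) + b * (a / n) = 0 by ring.
    by rewrite /slice_point scale0r addr0 scale1r.
  rewrite -[al]mulr1 -E mulrA.
  have -> : al * slice_point I a b = - slice_point I x y.
    by apply/eqP; rewrite -addr_eq0 addrC h.
  rewrite mulNr slice_pointM//; move: (a / n) (b / n) => p q.
  by rewrite /slice_point; apply: quat_ext; rewrite !qcoord; ring.
have a0 : a = 0 by apply/eqP; rewrite -sqrf_eq0; have := sqr_ge0 a; have := sqr_ge0 b; lra.
have b0 : b = 0 by apply/eqP; rewrite -sqrf_eq0; have := sqr_ge0 a; have := sqr_ge0 b; lra.
move: h; rewrite a0 b0 /slice_point !scale0r addr0 mulr0 addr0 => h.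
have := congr1 (@qnorm2 R) h.
rewrite -/(slice_point I x y) qnorm2_slice_point// (eqP (_ : qnorm2 0 == 0)); last by rewrite qnorm2_eq0.
move=> xy.
have x0 : x = 0 by apply/eqP; rewrite -sqrf_eq0; have := sqr_ge0 x; have := sqr_ge0 y; lra.
have y0 : y = 0 by apply/eqP; rewrite -sqrf_eq0; have := sqr_ge0 x; have := sqr_ge0 y; lra.
case=> -[|[|[|[|//]]]] i4.
- by rewrite -[RHS]x0; congr k; exact: val_inj.
- by rewrite -[RHS]y0; congr k; exact: val_inj.
- by rewrite -[RHS]a0; congr k; exact: val_inj.
- by rewrite -[RHS]b0; congr k; exact: val_inj.
Qed.

Lemma slice_basis_sum I al (c : 'I_4 -> R) :
  \sum_i c i *: tnth [tuple 1; I; al; al * I] i =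
  slice_point I (c (@Ordinal 4 0 isT)) (c (@Ordinal 4 1 isT)) +
  al * slice_point I (c (@Ordinal 4 2 isT)) (c (@Ordinal 4 3 isT)).
Proof.
rewrite !big_ord_recl big_ord0 addr0 /slice_point mulrDr -!scalerAr mulr1 !addrA.
rewrite !(tnth_nth 0) /=.
by congr (_ *: _ + _ *: _ + _ *: _ + _ *: _); congr c; exact: val_inj.
Qed.

Lemma nearest_int (x : R) : exists m : int, (x - m%:~R) ^+ 2 <= 4^-1.
Proof.
exists (Num.floor (x + 2^-1)).
have /andP[h1 h2] := real_floor_itv (num_real (x + 2^-1)).
rewrite intrD1 in h2.
set m := (_%:~R : R) in h1 h2 *.
have h : `|x - m| <= 2^-1 by rewrite ler_norml; apply/andP; split; lra.
have : `|x - m| ^+ 2 <= 2^-1 ^+ 2 by rewrite ler_sqr ?nnegrE.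
by rewrite real_normK ?num_real// => /le_trans; apply; lra.
Qed.

End SlicePlane.

(** * Reduced bases over the Gaussian integers *)

Lemma int_form_gram (R : realType) (v : 4.-tuple (quat R)) (n : 'rV[int]_4) :
  int_form (gram v) n = qnorm2 (\sum_i tnth v i *~ n ord0 i).
Proof.
rewrite /int_form /qnorm2 mxE.
under eq_bigr => i _ do rewrite !mxE mulr_suml.
rewrite exchange_big/=.
have dotl (p : 'I_4 -> quat R) q : qdot (\sum_i p i) q = \sum_i qdot (p i) q.
  rewrite /qdot exchange_big/=; apply: eq_bigr => j _.
  by rewrite summxE mulr_suml.
have dotC p q : qdot p q = qdot q p :> R.
  by rewrite /qdot; apply: eq_bigr => j _; rewrite mulrC.
have dotz p q (m : int) : qdot (p *~ m) q = m%:~R * qdot p q :> R.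
  rewrite /qdot mulr_sumr; apply: eq_bigr => j _.
  by rewrite -scaler_int mxE mulrA.
rewrite dotl; apply: eq_bigr => i _.
rewrite dotC dotl; apply: eq_bigr => j _.
by rewrite dotC !dotz dotC dotz !mxE dotC; ring.
Qed.

Section GaussianBasis.
Variables (R : realType) (L : lattice R) (I : quat R).
Hypothesis II : imag_units I.
Hypothesis L1 : lattice_set L 1.
Hypothesis min1 : forall q, lattice_set L q -> q != 0 -> 1 <= qnorm2 q.
Hypothesis LI : forall q, lattice_set L q -> lattice_set L (q * I).

Let gauss (m n : int) : quat R := slice_point I m%:~R n%:~R.

Let latticeM_gauss q m n : lattice_set L q -> lattice_set L (q * gauss m n).
Proof.
move=> Lq; rewrite /gauss /slice_point mulrDr -!scalerAr mulr1 !scaler_int.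
by apply: latticeD; apply: latticeMz => //; exact: LI.
Qed.

Let lattice_gauss m n : lattice_set L (gauss m n).
Proof. by rewrite -[gauss m n]mul1r; exact: latticeM_gauss. Qed.

Let slice_pointB x y x' y' :
  slice_point I x y - slice_point I x' y' = slice_point I (x - x') (y - y').
Proof. by rewrite /slice_point opprD addrACA -!scalerBl. Qed.

(** Rounding both coordinates leaves a remainder of squared norm at most 1/2,
    shorter than any nonzero vector of [L]. *)
Let plane_gauss q : lattice_set L q -> in_plane I q -> exists m n, q = gauss m n.
Proof.
move=> Lq [x [y qE]]; have [m hm] := nearest_int x; have [n hn] := nearest_int y.
exists m, n; apply/eqP; rewrite -subr_eq0; apply: contraT => h.
have := min1 (latticeB Lq (lattice_gauss m n)) h.
rewrite qE /gauss slice_pointB qnorm2_slice_point// => h1.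
by exfalso; move: h1 hm hn; lra.
Qed.

Let off_plane : set (quat R) := [set q | lattice_set L q /\ ~ in_plane I q].

Let exists_off_plane : off_plane !=set0.
Proof.
have [v fv Lv] := latticeP L; have [c cE _] := free_coordinates fv.
apply: contrapT => h; have [q] := exists_notin_plane II; apply.
have vI i : in_plane I (tnth v i).
  apply: contrapT => hi; apply: h; exists (tnth v i); split=> //.
  by rewrite Lv; exact: zspan_tnth.
rewrite (cE q); elim/big_ind: _ => [|x y [a [b ->]] [a' [b' ->]]|i _].
- by exists 0, 0; rewrite /slice_point !scale0r addr0.
- by exists (a + a'), (b + b'); rewrite /slice_point !scalerDl addrACA.
- have [a [b ->]] := vI i; exists (c i q * a), (c i q * b).
  by rewrite /slice_point scalerDr !scalerA.
Qed.

Let off_planeN q : off_plane q -> off_plane (- q).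
Proof.
move=> [Lq nq]; split; first exact: latticeN.
move=> [x [y qE]]; apply: nq; exists (- x), (- y).
by rewrite -[q]opprK qE /slice_point opprD !scaleNr.
Qed.

(** The squared norm of the orthogonal projection on the plane of [I]. *)
Let proj2 q := q0 q ^+ 2 + qdot q I ^+ 2.

(** Ties between shortest vectors are broken in favour of one that is not orthogonal
    to the plane.  The sign is chosen to satisfy the condition on consecutive
    entries of the reduced Gram matrix. *)
Let off_plane_min : exists al, [/\ off_plane al,
  forall q, off_plane q -> qnorm2 al <= qnorm2 q, 0 <= qdot al I &
  proj2 al <> 0 \/ forall q, off_plane q -> qnorm2 q = qnorm2 al -> proj2 q = 0].
Proof.
have [|al Sal almin] := lattice_exists_min (L := L) (S := off_plane) _ exists_off_plane.
  by move=> q [].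
have [be [Sbe bemin beP]] : exists be, [/\ off_plane be,
    forall q, off_plane q -> qnorm2 be <= qnorm2 q &
    proj2 be <> 0 \/ forall q, off_plane q -> qnorm2 q = qnorm2 be -> proj2 q = 0].
  have [[be [Sbe beal bep]]|h] :=
    pselect (exists be, [/\ off_plane be, qnorm2 be = qnorm2 al & proj2 be <> 0]).
    by exists be; split=> //; [rewrite beal|left].
  exists al; split=> //; right=> q Sq qal; apply: contrapT => hq.
  by apply: h; exists q.
have dN : qdot (- be) I = - qdot be I by rewrite !qdotE !qcoord; ring.
have pN : proj2 (- be) = proj2 be by rewrite /proj2 dN !qcoord !sqrrN.
have [t0|t0] := leP 0 (qdot be I); first by exists be.
exists (- be); split; rewrite ?qnorm2N ?pN//.
  exact: off_planeN.
by rewrite dN oppr_ge0 ltW.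
Qed.

(** With [D] the squared norm of the component of [al] orthogonal to the plane, the
    remainder of a division by 1 and [al] has squared norm at most [1/2 + D/2].
    If it were outside the plane, this would be at least the squared norm of [al],
    so [al] would have norm 1 and be orthogonal to the plane, while the remainder
    would be another shortest vector, not orthogonal to the plane: the choice made
    in [off_plane_min] excludes this.  In the Gram matrix, the reduction
    inequalities for the first two vectors bound nonzero vectors, and those for the
    last two bound vectors outside the plane. *)
Lemma normalized_gauss_basis : exists al, [/\ 1 <= qnorm2 al,
  special_basis [tuple 1; I; al; al * I] &
  lattice_set L = zspan [tuple 1; I; al; al * I]].
Proof.
have [al [[Lal nal] almin t0 alP]] := off_plane_min.
have al0 : al != 0.
  by apply/eqP => e; apply: nal; exists 0, 0; rewrite e /slice_point !scale0r addr0.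
have A1 := min1 Lal al0.
set v := [tuple 1; I; al; al * I].
have fv : free v by exact: free_slice_basis.
have Lv i : lattice_set L (tnth v i).
  have LII : lattice_set L I by rewrite -[I]mul1r; exact: LI.
  have LalI := LI Lal.
  by rewrite (tnth_nth 0); case: i => -[|[|[|[|//]]]].
have Dge0 : 0 <= qnorm2 al - q0 al ^+ 2 - qdot al I ^+ 2.
  have := qnorm2_basis al (- q0 al) (- qdot al I) 1 0 II.
  have := qnorm2_ge0 ((- q0 al)%:A + - qdot al I *: I + al * (1%:A + 0 *: I)).
  by set z := qnorm2 (_ + _) => z0 zE; move: z0; rewrite zE; lra.
have span q : lattice_set L q -> exists m n k l, q = gauss m n + al * gauss k l.
  move=> Lq; have [c cE _] := free_coordinates fv.
  have := cE q; rewrite slice_basis_sum.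
  set x := c _ q; set y := c _ q; set a := c _ q; set b := c _ q => qE.
  have [k hk] := nearest_int a; have [l hl] := nearest_int b.
  pose a' := a - k%:~R; pose b' := b - l%:~R.
  have [m hm] := nearest_int (x + a' * q0 al - b' * qdot al I).
  have [n hn] := nearest_int (y + a' * qdot al I + b' * q0 al).
  pose q' := q - (gauss m n + al * gauss k l).
  have Lq' : lattice_set L q'.
    by apply: latticeB => //; apply: latticeD; [exact: lattice_gauss|exact: latticeM_gauss].
  have q'E : q' = (x - m%:~R)%:A + (y - n%:~R) *: I + al * (a'%:A + b' *: I).
    rewrite /q' qE opprD addrACA /gauss slice_pointB.
    by rewrite -mulrBr slice_pointB.
  suff [i [j ij]] : exists i j, q' = gauss i j.
    exists (m + i), (n + j), k, l.
    rewrite -[q](subrK (gauss m n + al * gauss k l)) -/q' ij addrA; congr (_ + _).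
    by rewrite [LHS]addrC /gauss /slice_point !intrD !scalerDl [LHS]addrACA.
  apply: plane_gauss => //; apply: contrapT => nq'.
  have Sq' : off_plane q' by [].
  have N := qnorm2_basis al (x - m%:~R) (y - n%:~R) a' b' II.
  rewrite -q'E in N.
  set E := x - _ + _ - _ in N; set G := y - _ + _ + _ in N.
  have E2 : E ^+ 2 <= 4^-1 by move: hm; congr (_ ^+ 2 <= _); rewrite /E; ring.
  have G2 : G ^+ 2 <= 4^-1 by move: hn; congr (_ ^+ 2 <= _); rewrite /G; ring.
  rewrite -/a' in hk; rewrite -/b' in hl.
  have := almin _ Sq'; rewrite N => hmin.
  set Dl := qnorm2 al - _ - _ in N hmin Dge0.
  have ab : a' ^+ 2 + b' ^+ 2 <= 2^-1 by move: hk hl; lra.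
  have Dab : Dl * (a' ^+ 2 + b' ^+ 2) <= Dl * 2^-1 by apply: ler_wpM2l.
  have AD : qnorm2 al = Dl + q0 al ^+ 2 + qdot al I ^+ 2 by rewrite /Dl; ring.
  have s2 := sqr_ge0 (q0 al); have t2 := sqr_ge0 (qdot al I).
  (* The bounds leave room only for the extreme case. *)
  have s0 : q0 al ^+ 2 = 0 by move: Dab hmin E2 G2 AD A1; lra.
  have t0' : qdot al I ^+ 2 = 0 by move: Dab hmin E2 G2 AD A1; lra.
  have EG : E ^+ 2 + G ^+ 2 = 2^-1 by move: Dab hmin E2 G2 AD A1; lra.
  have Nq' : qnorm2 q' = qnorm2 al by apply/eqP; rewrite N eq_le; apply/andP; split; move: Dab hmin E2 G2 AD A1; lra.
  have sE : q0 al = 0 by apply/eqP; rewrite -sqrf_eq0 s0.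
  have tE : qdot al I = 0 by apply/eqP; rewrite -sqrf_eq0 t0'.
  case: alP => [|/(_ _ Sq' Nq')]; first by rewrite /proj2 s0 t0' addr0.
  have -> : proj2 q' = E ^+ 2 + G ^+ 2.
    have [I0 I1] := (imag_unitsP I).1 II.
    have e1 : q0 q' = E.
      have t3 : q1 al * q1 I + q2 al * q2 I + q3 al * q3 I = 0.
        by rewrite -[RHS]tE qdotE sE I0; ring.
      transitivity ((x - m%:~R) + a' * q0 al - b' * (q1 al * q1 I + q2 al * q2 I + q3 al * q3 I)).
        by rewrite q'E !qcoord I0; ring.
      by rewrite t3 /E tE.
    have e2 : qdot q' I = G.
      transitivity ((y - n%:~R) * (q1 I ^+ 2 + q2 I ^+ 2 + q3 I ^+ 2) +
          a' * qdot al I + b' * q0 al * (q1 I ^+ 2 + q2 I ^+ 2 + q3 I ^+ 2)).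
        by rewrite q'E !qdotE !qcoord I0; ring.
      by rewrite I1 !mulr1.
    by rewrite /proj2 e1 e2.
  by rewrite EG => /eqP; rewrite invr_eq0 pnatr_eq0.
exists al; split=> //; last first.
  apply/seteqP; split=> q; last by move=> [n ->]; exact: lattice_sum.
  move=> /span[m [n [k [l ->]]]].
  pose f (i : 'I_4) : int := nth 0 [:: m; n; k; l] i.
  exists f; transitivity (\sum_i (f i)%:~R *: tnth v i).
    by rewrite slice_basis_sum.
  by apply: eq_bigr => i _; rewrite scaler_int.
have sumE (n : 'rV[int]_4) : \sum_i tnth v i *~ n ord0 i =
    \sum_i (n ord0 i)%:~R *: tnth v i.
  by apply: eq_bigr => i _; rewrite scaler_int.
have Lsum (n : 'rV[int]_4) : lattice_set L (\sum_i tnth v i *~ n ord0 i).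
  exact: lattice_sum.
have low (n : 'rV[int]_4) i : n ord0 i != 0 -> 1 <= qnorm2 (\sum_i tnth v i *~ n ord0 i).
  move=> ni; apply: min1 => //; apply: contra ni; rewrite sumE => /eqP h.
  have := @free_inj R v (fun i => (n ord0 i)%:~R) (fun=> 0) fv.
  rewrite h big1; last by move=> j _; rewrite scale0r.
  by move=> /(_ erefl i)/eqP; rewrite intr_eq0.
have high (n : 'rV[int]_4) (i : 'I_4) : (2 <= i)%N -> n ord0 i != 0 ->
    qnorm2 al <= qnorm2 (\sum_i tnth v i *~ n ord0 i).
  move=> i2 ni; apply: almin; split=> // -[x [y]]; rewrite sumE => h.
  pose g (j : 'I_4) : R := nth 0 [:: x; y; 0; 0] j.
  have := @free_inj R v (fun i => (n ord0 i)%:~R) g fv.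
  have sp0 : slice_point I 0 0 = 0 by rewrite /slice_point !scale0r addr0.
  rewrite h slice_basis_sum /g/= sp0 mulr0 addr0.
  move=> /(_ erefl i).
  have -> : nth 0 [:: x; y; 0; 0] i = 0 by case: i i2 {ni} => -[|[|[|[|//]]]].
  by move=> /eqP; rewrite intr_eq0 (negbTE ni).
split=> //; split.
  move=> i j ij; rewrite mxE !(tnth_nth 0).
  case: i ij => -[|[|[|[|//]]]] ilt /=; case: j => -[|[|[|[|//]]]] jlt //= _.
  - by have [I0 _] := (imag_unitsP I).1 II; rewrite qdotE !qcoord I0 !mul0r mulr0 !addr0.
  - by rewrite (_ : qdot I al = qdot al I)// !qdotE; ring.
  - have [I0 _] := (imag_unitsP I).1 II.
    by rewrite (_ : qdot al (al * I) = 0)// qdotE !qcoord I0; ring.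
move=> k n hn.
have [i ki ni] : exists2 i : 'I_4, (k <= i)%N & n ord0 i != 0.
  apply: contrapT => h; move: hn; rewrite big1// => i ki.
  have [->//|ni] := eqVneq (n ord0 i) 0.
  by exfalso; apply: h; exists i.
rewrite int_form_gram mxE -/(qnorm2 _) (tnth_nth 0).
case: k ki hn => -[|[|[|[|//]]]] klt /= ki _.
- by rewrite qnorm21; exact: low ni.
- by rewrite (qnorm2_imag II); exact: low ni.
- exact: high ki ni.
- by rewrite qnorm2M (qnorm2_imag II) mulr1; apply: high ni; exact: ltnW.
Qed.

End GaussianBasis.

(** * Maps of tori induced by right multiplications *)

Section RightMultiplication.
Variable R : realType.
Implicit Types (L M : lattice R) (a c : quat R).

Definition mul_torus L M c (t : torus L) : torus M := torus_pi M (repr t * c).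

Definition maps_lattice L M c := forall q, lattice_set L q -> lattice_set M (q * c).

Lemma mul_torusE L M c q : maps_lattice L M c ->
  mul_torus M c (torus_pi L q) = torus_pi M (q * c).
Proof.
move=> Lc; apply/torus_piP; rewrite -mulrBl; apply: Lc.
by apply/torus_piP; rewrite /torus_pi reprK.
Qed.

(** In charts the map is locally [q |-> q * c - m] with [m] in [M].  On the slice of
    [I] its partial derivatives are the constants [c] and [I * c], which satisfy the
    equation because [I * (I * c) = - c]; a left multiplication would not. *)
Lemma torus_regular_mul L M c (F : torus L -> torus M) :
  (forall q, F (torus_pi L q) = torus_pi M (q * c)) -> torus_regular F.
Proof.
move=> FE U V cU cV; set Om := _ `&` _; set f := _ \o _.
have cmul : continuous (fun q : quat R => q * c).
  by apply: linear_quat_continuous => b p q; rewrite mulrDl scalerAl.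
have loc q0 : Om q0 -> exists r m, 0 < r /\
    forall q, ball q0 r q -> Om q /\ f q = q * c - m.
  move=> [Uq0 [v0 Vv0 v0E]].
  have [oU _ _] := cU; have [oV _ _] := cV.
  rewrite FE in v0E; pose m := q0 * c - v0.
  have Mm : lattice_set M m by apply/torus_piP.
  have c0 : (q * c - m) @[q --> q0] --> q0 * c - m.
    by have h := cmul q0; exact: (cvgB h (cvg_cst m)).
  have nV : \forall q \near q0, V (q * c - m).
    apply: c0; apply: open_nbhs_nbhs; split=> //.
    by rewrite /m opprB addrC subrK.
  have nU : \forall q \near q0, U q by apply: open_nbhs_nbhs.
  have [r /= r0 hr] : exists2 r : R, 0 < r & ball q0 r `<=` [set q | U q /\ V (q * c - m)].
    by apply/nbhs_ballP; exact: filterI nU nV.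
  exists r, m; split=> // q /hr[Uq Vq].
  have E : torus_pi M (q * c - m) = F (torus_pi L q).
    by rewrite FE; apply: torus_piDl; exact: latticeN.
  split; first by split=> //; exists (q * c - m).
  by rewrite /f /= -E chart_torus_pi.
have oOm : open Om.
  rewrite openE => q0 /loc[r [m [r0 hr]]].
  by apply/nbhs_ballP; exists r => // q /hr[].
have dloc I x0 y0 : slice_dom Om I (x0, y0) ->
    is_derive x0 1 (fun t : R => slice_restr f I t y0) c /\
    is_derive y0 1 (fun t : R => slice_restr f I x0 t) (I * c).
  move=> /= Omxy; have [r [m [r0 hr]]] := loc _ Omxy.
  have [s s0 hs] := slice_point_ball I x0 y0 r0.
  have fE x y : `|x - x0| < s -> `|y - y0| < s ->
      slice_restr f I x y = slice_point I x y * c - m.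
    by move=> xs ys; apply: (hr _ _).2; exact: hs.
  have E x y : slice_point I x y * c - m = x *: c + (y *: (I * c) - m).
    by rewrite /slice_point mulrDl -!scalerAl mul1r addrA.
  have dl (w b : quat R) (t : R) : is_derive t 1 (fun u : R => u *: w + b) w.
    apply/is_derive1P; apply: cvg_near_cst.
    have : \forall h \near (0 : R)^', h != 0 by exact: nbhs_dnbhs_neq.
    apply: filterS => h h0.
    by rewrite opprD addrACA subrr addr0 -scalerBl addrK scalerA mulVf// scale1r.
  split.
    refine (@is_derive_eq_dist R (quat R) _ (fun x => x *: c + (y0 *: (I * c) - m)) x0 s _ s0 _ _).
      by move=> x xs; rewrite fE ?subrr ?normr0// E.
  refine (@is_derive_eq_dist R (quat R) _ (fun y => y *: (I * c) + (x0 *: c - m)) y0 s _ s0 _ _).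
    by move=> y ys; rewrite fE ?subrr ?normr0// E addrCA.
have dxE I x y : slice_dom Om I (x, y) -> slice_dx f I x y = c.
  by move=> /dloc[[_ h] _]; rewrite /slice_dx derive1E.
have dyE I x y : slice_dom Om I (x, y) -> slice_dy f I x y = I * c.
  by move=> /dloc[_ [_ h]]; rewrite /slice_dy derive1E.
have within_cst (A : set (R * R)) (k : quat R) (g : R * R -> quat R) :
    (forall z, A z -> g z = k) -> {within A, continuous g}.
  move=> gk.
  have ck : {within A, continuous (fun=> k)}.
    by apply: continuous_subspaceT => z; exact: cvg_cst.
  apply: subspace_eq_continuous ck.
  by move=> z /set_mem /gk.
split=> // I II; split.
- move=> x y /dloc[[h1 _] [h2 _]]; split; [exact: h1|exact: h2].
- by apply: (within_cst _ c) => -[x y]; exact: dxE.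
- by apply: (within_cst _ (I * c)) => -[x y]; exact: dyE.
- by move=> x y h; rewrite (dxE I x y h) (dyE I x y h) (imag_unitsM _ II) subrr; exact: scaler0.
Qed.

Lemma mul_tori_equivalent L M c : c != 0 ->
  (forall q, lattice_set L q <-> lattice_set M (q * c)) -> tori_equivalent L M.
Proof.
move=> c0 LM.
have Lc : maps_lattice L M c by move=> q /LM.
have Mc : maps_lattice M L (qinv c).
  by move=> q Mq; apply/LM; rewrite -mulrA qmulVl// mulr1.
exists (mul_torus M c); split.
  by apply: (@torus_regular_mul L M c) => q; exact: mul_torusE.
exists (mul_torus L (qinv c)); split.
- move=> t; have [q <-] := torus_pi_surj t.
  by rewrite !mul_torusE// -mulrA qmulV// mulr1.
- move=> t; have [q <-] := torus_pi_surj t.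
  by rewrite !mul_torusE// -mulrA qmulVl// mulr1.
by apply: (@torus_regular_mul M L (qinv c)) => q; exact: mul_torusE.
Qed.

(** Otherwise the multiples of [b] would fill the space, against discreteness. *)
Lemma lattice_no_line L b : (forall q, lattice_set L (q * b)) -> b = 0.
Proof.
move=> h; apply/eqP; apply: contraT => b0.
have [e e0 sep] := lattice_separated L.
have n1 : 0 < `|1 : quat R| by rewrite normr_gt0 oner_neq0.
pose q : quat R := (e / 2 / `|1 : quat R|)%:A.
have : lattice_set L q by rewrite -[q]mulr1 -(qmulVl b0) mulrA.
move/sep; rewrite /q normrZ ger0_norm ?divr_ge0// ?ltW//.
rewrite divfK ?gt_eqF// => /(_ _)/eqP; rewrite scaler_eq0 oner_eq0 orbF.
rewrite mulf_eq0 invr_eq0 (gt_eqF n1) orbF mulf_eq0 gt_eqF//= invr_eq0 pnatr_eq0 /=.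
by apply; rewrite ltr_pdivrMr// ltr_pMr// ltr1n.
Qed.

Lemma torus_mul_inj L a b :
  (forall q, torus_pi L (q * a) = torus_pi L (q * b)) -> a = b.
Proof.
move=> h; apply/eqP; rewrite -subr_eq0; apply/eqP; apply: (@lattice_no_line L) => q.
by rewrite mulrBr; apply/torus_piP.
Qed.

Lemma scale_lattice L c : c != 0 ->
  exists L' : lattice R, forall q, lattice_set L' q <-> lattice_set L (q * c).
Proof.
move=> c0; have [v fv Lv] := latticeP L.
pose v' := [tuple of [seq q * qinv c | q <- v]].
have tE i : tnth v' i = tnth v i * qinv c by rewrite tnth_map.
have fv' : free v'.
  apply/freeP => k h; apply: (@free_inj R v k (fun=> 0) fv).
  rewrite [RHS]big1; last by move=> i _; rewrite scale0r.
  have := congr1 (fun q => q * c) h; rewrite mul0r mulr_suml => h'.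
  apply: etrans h'; apply: eq_bigr => i _.
  by rewrite -(tnth_nth 0 v' i) tE -scalerAl -mulrA qmulVl// mulr1.
have lP : exists2 w : 4.-tuple (quat R), free w & zspan v' = zspan w by exists v'.
exists (Lattice lP) => q /=; rewrite Lv; split=> -[n qE]; exists n.
  rewrite qE mulr_suml; apply: eq_bigr => i _.
  by rewrite tE mulrzAl -mulrA qmulVl// mulr1.
rewrite -[q]mulr1 -(qmulV c0) mulrA qE mulr_suml; apply: eq_bigr => i _.
by rewrite tE mulrzAl.
Qed.

End RightMultiplication.

(** * Cyclic groups of order four *)

Section CyclicGroupsOfOrderFour.
Variable R : realType.
Implicit Types (I J q : quat R).

Definition cyclic4 I : set (quat R) := [set q | [\/ q = 1, q = -1, q = I | q = - I]].

Lemma imag_units_sqr I : imag_units I -> I * I = -1.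
Proof. by move=> II; rewrite -expr2. Qed.

Lemma is_group_cyclic4 I : imag_units I -> is_group *%R 1 (cyclic4 I).
Proof.
move=> /imag_units_sqr II; split; first exact: Or41.
  move=> x y [->|->|->|->] [->|->|->|->];
  rewrite ?(mul1r, mulr1, mulN1r, mulrN1, mulNr, mulrN, II, opprK);
  by [exact: Or41|exact: Or42|exact: Or43|exact: Or44].
move=> x [->|->|->|->].
- by exists 1; [exact: Or41|rewrite mul1r].
- by exists (-1); [exact: Or42|rewrite mulN1r opprK].
- by exists (- I); [exact: Or44|rewrite mulrN mulNr II opprK].
- by exists I; [exact: Or43|rewrite mulrN mulNr II opprK].
Qed.

Lemma cyclic4_S3 I : imag_units I -> cyclic4 I `<=` @S3 R.
Proof.
move=> II q h; apply/S3P.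
by case: h => ->; rewrite ?qnorm2N ?qnorm21 ?(qnorm2_imag II).
Qed.

Lemma gen_S3_cyclic4 I (X : set (quat R)) : imag_units I -> X I -> X `<=` cyclic4 I ->
  gen_S3 X = cyclic4 I.
Proof.
move=> II XI Xc; apply/seteqP; split.
  apply: smallest_sub => //; split; [exact: cyclic4_S3|exact: is_group_cyclic4].
move=> q hq G [[_ [_ GM _]] XG].
have GI := XG _ XI.
have G2 : G (-1) by rewrite -(imag_units_sqr II); exact: GM.
case: hq => -> //.
- by rewrite -[1]opprK -[- - 1]mulN1r; exact: GM.
- by rewrite -mulN1r; exact: GM.
Qed.

Lemma C2_2E I : imag_units I -> C2_2 I = cyclic4 I.
Proof. by move=> II; apply: gen_S3_cyclic4 => // q ->; exact: Or43. Qed.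

Lemma D2_2E J : imag_units J -> D2_2 J = cyclic4 J.
Proof.
move=> JJ; apply: gen_S3_cyclic4 => //; first by right.
by move=> q [->|->]; [exact: Or42|exact: Or43].
Qed.

(** The isomorphism of the planes of [I] and [J] as fields, extended to the whole
    space by orthogonal projection; it restricts to [cyclic4 I]. *)
Definition plane_map I J q := slice_point J (q0 q) (qdot q I).

Lemma plane_mapE I J x y : imag_units I ->
  plane_map I J (slice_point I x y) = slice_point J x y.
Proof. by move=> II; rewrite /plane_map q0_slice_point// qdot_slice_point. Qed.

Lemma slice_point10 I : slice_point I 1 0 = 1.
Proof. by rewrite /slice_point scale1r scale0r addr0. Qed.
Lemma slice_pointN10 I : slice_point I (-1) 0 = -1.
Proof. by rewrite /slice_point scaleN1r scale0r addr0. Qed.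
Lemma slice_point01 I : slice_point I 0 1 = I.
Proof. by rewrite /slice_point scale1r scale0r add0r. Qed.
Lemma slice_point0N1 I : slice_point I 0 (-1) = - I.
Proof. by rewrite /slice_point scaleN1r scale0r add0r. Qed.

Lemma cyclic4_in_plane I q : cyclic4 I q -> in_plane I q.
Proof.
case=> ->.
- by exists 1, 0; rewrite slice_point10.
- by exists (-1), 0; rewrite slice_pointN10.
- by exists 0, 1; rewrite slice_point01.
- by exists 0, (-1); rewrite slice_point0N1.
Qed.

Lemma plane_map_cyclic4 I J q : imag_units I -> cyclic4 I q -> cyclic4 J (plane_map I J q).
Proof.
move=> II [->|->|->|->].
- by rewrite -(slice_point10 I) plane_mapE// slice_point10; exact: Or41.
- by rewrite -(slice_pointN10 I) plane_mapE// slice_pointN10; exact: Or42.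
- by rewrite -{2}(slice_point01 I) plane_mapE// slice_point01; exact: Or43.
- by rewrite -(slice_point0N1 I) plane_mapE// slice_point0N1; exact: Or44.
Qed.

Lemma plane_mapK I J q : imag_units I -> imag_units J -> in_plane I q ->
  plane_map J I (plane_map I J q) = q.
Proof. by move=> II JJ [x [y ->]]; rewrite !plane_mapE. Qed.

Lemma plane_mapM I J p q : imag_units I -> imag_units J ->
  in_plane I p -> in_plane I q ->
  plane_map I J (p * q) = plane_map I J p * plane_map I J q.
Proof.
move=> II JJ [x [y ->]] [x' [y' ->]].
by rewrite slice_pointM// !plane_mapE// slice_pointM.
Qed.

Lemma plane_mulC I p q : imag_units I -> in_plane I p -> in_plane I q -> p * q = q * p.
Proof.
move=> II [x [y ->]] [x' [y' ->]]; rewrite !slice_pointM//.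
by congr (slice_point I _ _); ring.
Qed.

Lemma cyclic4_isomorphic I J : imag_units I -> imag_units J ->
  group_isomorphic *%R *%R (cyclic4 I) (cyclic4 J).
Proof.
move=> II JJ; exists (plane_map I J); last first.
  by move=> x y /cyclic4_in_plane hx /cyclic4_in_plane hy; exact: plane_mapM.
split.
- by move=> q; exact: plane_map_cyclic4.
- move=> p q /set_mem/cyclic4_in_plane hp /set_mem/cyclic4_in_plane hq /(congr1 (plane_map J I)).
  by rewrite !plane_mapK.
- move=> q hq; exists (plane_map J I q); first exact: plane_map_cyclic4.
  by apply: plane_mapK => //; exact: cyclic4_in_plane.
Qed.

End CyclicGroupsOfOrderFour.

(** * Automorphisms of order four *)

Section AutomorphismsOfOrderFour.
Variables (R : realType) (L : lattice R).

(** Composition of right multiplications reverses the product, which is harmless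
    inside the commutative plane of [b]. *)
Lemma order4_aut (J b : quat R) : imag_units J -> imag_units b -> maps_lattice L L b ->
  aut_has_subgroup_iso L (cyclic4 J).
Proof.
move=> JJ bb Lb.
have Lc q : cyclic4 b q -> maps_lattice L L q.
  case=> -> l Ll; first by rewrite mulr1.
  - by rewrite mulrN1; exact: latticeN.
  - exact: Lb.
  - by rewrite mulrN; apply: latticeN; exact: Lb.
pose h := plane_map J b.
have hc q : cyclic4 J q -> cyclic4 b (h q) by exact: plane_map_cyclic4.
have hM p q : cyclic4 J p -> cyclic4 J q -> h (p * q) = h p * h q.
  by move=> /cyclic4_in_plane hp /cyclic4_in_plane hq; exact: plane_mapM.
pose phi q : torus L -> torus L := mul_torus L (h q).
have phiE q x : cyclic4 J q -> phi q (torus_pi L x) = torus_pi L (x * h q).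
  by move=> /hc/Lc; exact: mul_torusE.
have [G1 GM GV] := is_group_cyclic4 JJ.
have phiM p q : cyclic4 J p -> cyclic4 J q -> phi (p * q) = phi p \o phi q.
  move=> hp hq; apply/funext => t; have [x <-] := torus_pi_surj t.
  rewrite /= !phiE//; last exact: GM.
  rewrite -mulrA hM//; congr (torus_pi L (_ * _)).
  by apply: (plane_mulC bb); apply: cyclic4_in_plane; exact: hc.
have phi1 : phi 1 = id.
  apply/funext => t; have [x <-] := torus_pi_surj t; rewrite phiE//.
  by rewrite /h -(slice_point10 J) plane_mapE// slice_point10 mulr1.
exists (phi @` cyclic4 J); split.
- move=> _ [q hq <-]; exists (h q); split.
  + by apply: (cyclic4_S3 bb); exact: hc.
  + have [q' hq' [qq' q'q]] := GV _ hq.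
    apply/seteqP; split=> l; first by move=> [x Lx <-]; apply: Lc => //; exact: hc.
    move=> Ll; exists (l * h q'); first by apply: Lc => //; exact: hc.
    rewrite -mulrA -hM// q'q /h -(slice_point10 J) plane_mapE//.
    by rewrite slice_point10 mulr1.
  + by move=> x; exact: phiE.
- split; first by exists 1.
    move=> _ _ [p hp <-] [q hq <-]; exists (p * q); first exact: GM.
    by rewrite phiM.
  move=> _ [q hq <-]; have [q' hq' [qq' q'q]] := GV _ hq.
  exists (phi q'); first by exists q'.
  by rewrite -!phiM// qq' q'q phi1.
- exists phi; last exact: phiM.
  split.
  + by move=> q hq; exists q.
  + move=> p q /set_mem hp /set_mem hq pq.
    have : h p = h q.
      apply: (@torus_mul_inj R L) => x.
      by rewrite -!phiE// pq.
    move=> /(congr1 (plane_map b J)).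
    by rewrite !plane_mapK//; exact: cyclic4_in_plane.
  + by move=> _ [q hq <-]; exists q.
Qed.

(** Since a multiplier is determined by the map it induces, the image of [J] is the
    multiplication by some [a] with [a ^+ 4 = 1] and [a ^+ 2 != 1]; a division ring
    leaves [a ^+ 2 = -1]. *)
Lemma order4_aut_imag (J : quat R) : aut_has_subgroup_iso L (cyclic4 J) -> imag_units J ->
  exists2 a : quat R, imag_units a & maps_lattice L L a.
Proof.
move=> [H [HA [Hid _ _] [phi [phiH phiI phiS] phiM]]] JJ.
have [C1 CN CJ] : [/\ cyclic4 J 1, cyclic4 J (-1) & cyclic4 J J].
  by split; [exact: Or41|exact: Or42|exact: Or43].
have [a [_ aL aE]] := HA _ (phiH _ CJ).
have La : maps_lattice L L a by move=> l Ll; rewrite -aL; exists l.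
exists a => //.
have phi1 : phi 1 = id.
  have [x hx xid] := phiS _ Hid.
  by have := phiM _ _ C1 hx; rewrite mul1r xid.
have phi2 q : phi (-1) (torus_pi L q) = torus_pi L (q * (a * a)).
  by rewrite -(imag_units_sqr JJ) phiM//= !aE mulrA.
have phi4 q : torus_pi L (q * 1) = torus_pi L (q * ((a * a) * (a * a))).
  rewrite mulr1 mulrA -!phi2 -[LHS]/(id (torus_pi L q)) -phi1.
  (* [1] is written as [(-1) * (-1)], that is [J ^+ 4]. *)
  by rewrite -[in LHS](opprK 1) -[- - 1]mulN1r phiM.
have a4 := torus_mul_inj phi4.
have /eqP : (a * a - 1) * (a * a + 1) = 0.
  by rewrite mulrDr mulr1 mulrBl mul1r -a4 addrA subrK subrr.
rewrite qmul_eq0 => /orP[/eqP a2|]; last by rewrite /imag_units/= expr2 addr_eq0 => /eqP.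
have {}a2 : a * a = 1 by apply/eqP; rewrite -subr_eq0 a2.
have : phi (-1) = phi 1.
  apply/funext => t; have [q <-] := torus_pi_surj t.
  by rewrite phi2 a2 mulr1 phi1.
move=> /phiI; rewrite !inE => /(_ CN C1) /(congr1 (@q0 R)).
rewrite !qcoord => h.
by have := @ltr01 R; lra.
Qed.

(** Dividing on the right by a shortest vector [w] conjugates the multiplier into
    [I = w * a * w^-1] and normalizes the lattice. *)
Lemma order4_modulus (a : quat R) : imag_units a -> maps_lattice L L a ->
  exists I al, [/\ imag_units I, 1 <= qnorm al & is_modulus L (I, al, al * I)].
Proof.
move=> aa La.
have [||w [Lw w0] wmin] :=
    lattice_exists_min (L := L) (S := [set q | lattice_set L q /\ q != 0]).
- by move=> q [].
- apply: contrapT => h; have [v fv Lv] := latticeP L; have [c cE _] := free_coordinates fv.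
  have : (1 : quat R) = 0.
    rewrite (cE 1) big1// => i _.
    rewrite (_ : tnth v i = 0) ?scaler0//; apply: contrapT => vi; apply: h.
    exists (tnth v i); split; last exact/eqP.
    by rewrite Lv; exact: zspan_tnth.
  by move/eqP; rewrite oner_eq0.
have [L' L'E] := scale_lattice L w0.
pose I := w * a * qinv w.
have Iw : I * w = w * a by rewrite /I -mulrA qmulVl// mulr1.
have II : imag_units I.
  rewrite /imag_units/= expr2 {2}/I !mulrA Iw -[w * a * a]mulrA (imag_units_sqr aa).
  by rewrite mulrN1 mulNr qmulV.
have Nw : 0 < qnorm2 w by rewrite qnorm2_gt0.
have [||q|al [al1 sp L'sp]] := @normalized_gauss_basis R L' I II.
- by apply/L'E; rewrite mul1r.
- move=> q /L'E Lqw q0.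
  rewrite -(ler_pM2r Nw) mul1r -qnorm2M; apply: wmin; split=> //.
  by rewrite qmul_eq0 negb_or q0.
- by move=> /L'E Lqw; apply/L'E; rewrite -mulrA Iw mulrA; exact: La.
exists I, al; split=> //.
  by rewrite /qnorm -/(qnorm2 al) -[1]sqrtr1 ler_sqrt// qnorm2_ge0.
split=> //; exists L' => //.
apply: (@mul_tori_equivalent R L L' (qinv w)); first exact: qinv_neq0.
move=> q; split=> [Lq|/L'E]; first by apply/L'E; rewrite -mulrA qmulVl// mulr1.
by rewrite -mulrA qmulVl// mulr1.
Qed.

(** By rigidity and injectivity of the equivalence, [L] is the preimage of the
    special lattice under [q |-> q * a], so [I] acts on [L] through
    [a * I * a^-1]. *)
Lemma modulus_order4 (I al : quat R) : imag_units I -> is_modulus L (I, al, al * I) ->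
  exists2 b : quat R, imag_units b & maps_lattice L L b.
Proof.
move=> II [_ [M ME [F [regF [G [FK _ _]]]]]].
have [a [c Fac]] := torus_regular_affine regF.
have LM q : lattice_set L q <-> lattice_set M (q * a).
  have E : F (torus_pi L q) = F (torus_pi L 0) <-> lattice_set M (q * a).
    rewrite !Fac; have := torus_piP M (c + q * a) (c + 0 * a).
    by rewrite mul0r addr0 addrAC subrr add0r.
  split=> [Lq|/E/(can_inj FK)/torus_piP]; last by rewrite subr0.
  by apply/E; congr F; apply/torus_piP; rewrite subr0.
have a0 : a != 0.
  apply/eqP => a0; have : (1 : quat R) = 0.
    apply: (@lattice_no_line R L) => q; apply/LM.
    by rewrite a0 mulr0; exact: lattice0.
  by move/eqP; rewrite oner_eq0.
have MI q : lattice_set M q -> lattice_set M (q * I).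
  have Mi i : lattice_set M (tnth [tuple 1; I; al; al * I] i).
    by rewrite ME; exact: zspan_tnth.
  rewrite {1}ME => -[n ->]; rewrite mulr_suml.
  elim/big_ind: _ => [|x y|i _]; [exact: lattice0|exact: latticeD|].
  rewrite mulrzAl; apply: latticeMz.
  have := Mi (@Ordinal 4 0 isT); have := Mi (@Ordinal 4 1 isT).
  have := Mi (@Ordinal 4 2 isT); have := Mi (@Ordinal 4 3 isT).
  rewrite !(tnth_nth 0) /= => m3 m2 m1 m0.
  case: i => -[|[|[|[|//]]]] /= _; rewrite ?mul1r//.
  - by rewrite (imag_units_sqr II); exact: latticeN.
  - by rewrite -mulrA (imag_units_sqr II) mulrN1; exact: latticeN.
exists (a * I * qinv a).
  rewrite /imag_units/= expr2 -!mulrA (mulrA (qinv a)) qmulVl// mul1r.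
  by rewrite (mulrA I) (imag_units_sqr II) mulN1r mulrN qmulV.
move=> l /LM Mla; apply/LM.
by rewrite -!mulrA qmulVl// mulr1 mulrA; exact: MI.
Qed.

End AutomorphismsOfOrderFour.

Theorem proposition8p10 (R : realType) (L : lattice R) :
  (forall I J : quat R, imag_units I -> imag_units J ->
     group_isomorphic *%R *%R (C2_2 I) (D2_2 J)) /\
  (forall J : quat R, imag_units J ->
     (aut_has_subgroup_iso L (C2_2 J) <->
      exists I alpha3 : quat R,
        [/\ imag_units I, 1 <= qnorm alpha3 &
            is_modulus L (I, alpha3, alpha3 * I)])).
Proof.
split=> [I J II JJ|J JJ]; first by rewrite C2_2E// D2_2E//; exact: cyclic4_isomorphic.
rewrite C2_2E//; split=> [h|[I [al [II _ mod_al]]]].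
  have [a aa La] := order4_aut_imag h JJ; exact: order4_modulus aa La.
by have [b bb Lb] := modulus_order4 II mod_al; exact: order4_aut JJ bb Lb.
Qed.
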